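(* Let $G$ be an $n$-dimensional Lie group with Lie algebra $\mathfrak g=\mathrm{span}\{e_1,\dots,e_n\}$, let $r$ agents $i\in\mathcal N=\{1,\dots,r\}$ be related by a static, connected, undirected graph $\mathcal G=(\mathcal N,\mathcal E)$ with neighbor sets $\mathcal N_i$, and consider the optimal control problem of minimizing, over configurations $g(\cdot)=(g_1(\cdot),\dots,g_r(\cdot))$ and controls $u(\cdot)=(u_1(\cdot),\dots,u_r(\cdot))$, $$\sum_{i=1}^r\int_0^T\Big[C_i(g_i(t),u_i(t))+\tfrac12\sum_{j\in\mathcal N_i}V_{ij}(g_i(t),g_j(t))\Big]dt$$ subject to $\dot g_i=T_{\bar e_i}L_{g_i}(u_i)$, $u_i(t)=\sum_{k=1}^m u_i^k(t)e_k$ ($m\le n$), and boundary values $g_i(0)=g_i^0$, $g_i(T)=g_i^T$, $i=1,\dots,r$, with $C_i$ and $V_{ij}$ as in the context. Let $\mathbf C:G^r\times\mathfrak g^r\to\mathbb R$, $\mathbf C(g,u)=\sum_{i=1}^r C_i(g_i,u_i)$. If $\mathbf C$ is invariant under the left action of $G$ on $G^r\times\mathfrak g^r$ given by $\rho_h(g,u)=(L_hg_1,\dots,L_hg_r,u)$, $h\in G$, then extremals of the cost functional of this problem satisfy the equations $$0=\frac{d}{dt}\left(\frac{\partial C_i}{\partial u_i}+\lambda_i\right)-\mathrm{ad}^*_{u_i}\left(\frac{\partial C_i}{\partial u_i}+\lambda_i\right)-\sum_{j\in\mathcal N_i}T^*_{\bar e_i}L_{g_i}\left(\frac{\partial \mathbf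 V_{ij}}{\partial g_i}\right)$$ together with $\dot g_i=T_{\bar e_i}L_{g_i}(u_i)$, for $i=1,\dots,r$, where $\mathbf V_{ij}:G\to\mathbb R$ is given by $\mathbf V_{ij}(g_i^{-1}g_j)=V_{ij}(\bar e_i,g_i^{-1}g_j)$ and the $\lambda_i$ are the Lagrange multipliers described in the context.
   Context: Notation. $\bar e_i$ is the identity of the $i$-th copy of $G$; $L_g(h)=gh$; $T_{\bar e}L_g:\mathfrak g\to T_gG$ is its tangent map at the identity; $T^*_{\bar e}L_g:T^*_gG\to\mathfrak g^*$ is the dual of $T_{\bar e}L_g$, and $T^*_gL_{g^{-1}}:\mathfrak g^*\to T^*_gG$ is the dual of $T_gL_{g^{-1}}$. $\mathrm{ad}_\xi\eta=[\xi,\eta]$, and $\mathrm{ad}^*_\xi:\mathfrak g^*\to\mathfrak g^*$ is defined by $\langle \mathrm{ad}^*_\xi\mu,\eta\rangle=\langle\mu,\mathrm{ad}_\xi\eta\rangle$. $\{e^1,\dots,e^n\}$ is the basis of $\mathfrak g^*$ dual to $\{e_1,\dots,e_n\}$. $\mathcal N_i=\{j\in\mathcal N:(i,j)\in\mathcal E\}$. $T$ is fixed and $g_i\in C^1([0,T],G)$. Cost functions and potentials. Each $C_i:G\times\mathfrak g\to\mathbb R$ is invariant under the left action $(g_i,u_i)\mapsto(L_gg_i,u_i)$, $g\in G$ (so it can be written as a function of $u_i$ only). The potential functions $V_{ij}:G\times G\to\mathbb R$ ($i\in\mathcal N$, $j\in\mathcal N_i$) satisfy $V_{ij}=V_{ji}$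 and are sufficiently regular. $\frac{\partial\mathbf V_{ij}}{\partial g_i}\in T^*_{g_i}G$ is the partial derivative, with respect to $g_i$, of $\mathbf V_{ij}(g_i^{-1}g_j)$. Extremals and multipliers. The problem is treated as a constrained variational problem with Lagrange multipliers $\lambda_{g_i}=T^*_{g_i}L_{g_i^{-1}}(\lambda_i)\in T^*_{g_i}G$, where $\lambda_i\in C^1([0,T],\mathfrak g^* )$ has the form $\lambda_i=\sum_{k=m+1}^n\lambda_i^ke^k$, and extended Lagrangian $$\mathcal L(g,u,\lambda_g)=\mathbf C(g,u)+\sum_{i=1}^r\Big(\langle\lambda_{g_i},T_{\bar e_i}L_{g_i}u_i\rangle+\tfrac12\sum_{j\in\mathcal N_i}V_{ij}(g_i,g_j)\Big).$$ Extremals are the curves for which $\delta\int_0^T\mathcal L(g,u,\lambda_g)\,dt=0$ for variations of $g$ with $\delta g(0)=\delta g(T)=0$ and the variations of $u$ they induce, namely $\delta u_i=\dot\eta_i+\mathrm{ad}_{u_i}\eta_i$ with $\eta_i=T_{g_i}L_{g_i^{-1}}(\delta g_i)\in\mathfrak g$, $\eta_i(0)=\eta_i(T)=0$.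
   Formalization: The potentials V_ij are additionally assumed left-invariant, V_ij(hg,hg') = V_ij(g,g'), without which the claim fails; V_ij = V_ji is read as V_ij(g,g') = V_ji(g',g); C_i is taken C^1 in u_i and V_ij is taken C^1. *)

(* Defs.v *)
From HB Require Import structures.
From mathcomp Require Import all_boot all_order all_algebra.
From mathcomp Require Import all_classical all_reals all_analysis.
Set Implicit Arguments.
Unset Strict Implicit.
Unset Printing Implicit Defensive.
Import Order.TTheory GRing.Theory Num.Theory.
Import numFieldNormedType.Exports.
Local Open Scope classical_set_scope.
Local Open Scope ring_scope.

(* [Ck k f A] is the usual C^k regularity when A is open and V is
   finite-dimensional, the only case in which it is used. *)
Fixpoint Ck (R : realType) (k : nat) (V W : normedModType R) (f : V -> W)
    (A : set V) : Prop :=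
  match k with
  | 0 => forall x, A x -> {for x, continuous f}
  | k'.+1 => (forall x, A x -> differentiable f x) /\
             (forall v, Ck k' (fun x => 'D_v f x) A)
  end.

Definition smooth_on (R : realType) (V W : normedModType R) (f : V -> W)
  (A : set V) : Prop := forall k, Ck k f A.

(* An n-dimensional Lie group.  The smooth structure is given by an atlas
   indexed by the points of G: [chart p] is a coordinate map on the open
   neighbourhood [chart_dom p] of p, with inverse [chart_inv p]; the values of
   [chart p] and [chart_inv p] elsewhere are irrelevant. *)
HB.mixin Record isLieGroup (R : realType) (n : nat) G
    of Group G & Topological G := {
  chart_dom : G -> set G;
  chart : G -> G -> 'rV[R]_n;
  chart_inv : G -> 'rV[R]_n -> G;
  lie_hausdorff : hausdorff_space G;
  lie_second_countable : @second_countable G;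
  chart_dom_open : forall p, open (chart_dom p);
  chart_dom_center : forall p, chart_dom p p;
  chart_img_open : forall p, open (chart p @` chart_dom p);
  chartK : forall p q, chart_dom p q -> chart_inv p (chart p q) = q;
  chart_continuous : forall p q, chart_dom p q ->
    {for q, continuous (chart p)};
  chart_inv_continuous : forall p q, chart_dom p q ->
    {for chart p q, continuous (chart_inv p)};
  chart_transition : forall p q,
    smooth_on (chart q \o chart_inv p)
              (chart p @` (chart_dom p `&` chart_dom q));
  lie_mul_continuous : continuous (fun x : G * G => (x.1 * x.2)%g);
  lie_mul_smooth : forall p q,
    smooth_on (fun x : 'rV[R]_n * 'rV[R]_n =>
                 chart (p * q)%g (chart_inv p x.1 * chart_inv q x.2)%g)
      [set x | [/\ (chart p @` chart_dom p) x.1,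
                   (chart q @` chart_dom q) x.2 &
                   chart_dom (p * q)%g
                     (chart_inv p x.1 * chart_inv q x.2)%g]];
  lie_inv_continuous : continuous (fun x : G => (x^-1)%g);
  lie_inv_smooth : forall p,
    smooth_on (fun x => chart (p^-1)%g ((chart_inv p x)^-1)%g)
      [set x | (chart p @` chart_dom p) x /\
               chart_dom (p^-1)%g ((chart_inv p x)^-1)%g]
}.

#[short(type="lieGroupType")]
HB.structure Definition LieGroup (R : realType) (n : nat) :=
  {G of isLieGroup R n G & Group G & Topological G}.

(* A tangent vector at p is represented by its coordinates in the chart
   attached to p, a row vector; a covector at p by a column vector.  In
   particular the Lie algebra, the tangent space at 1, is 'rV[R]_n and its
   dual is 'cV[R]_n. *)
Definition pairing (R : realType) (n : nat) (mu : 'cV[R]_n) (v : 'rV[R]_n) : R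
  := (v *m mu) 0 0.

Definition dual_map (R : realType) (n : nat) (f : 'rV[R]_n -> 'rV[R]_n)
  (mu : 'cV[R]_n) : 'cV[R]_n := \col_k pairing mu (f (delta_mx 0 k)).

Definition covector (R : realType) (n : nat) (f : 'rV[R]_n -> R)
  (x : 'rV[R]_n) : 'cV[R]_n := \col_k 'd f x (delta_mx 0 k).

(* [deriv_in A f t v]: v is the derivative of f at t relative to A, hence
   one-sided at the endpoints when A is a segment. *)
Definition deriv_in (R : realType) (W : normedModType R) (A : set R)
  (f : R -> W) (t : R) (v : W) : Prop :=
  (fun s => (s - t)^-1 *: (f s - f t)) @ within A t^' --> v.

Definition C1_on (R : realType) (W : normedModType R) (T : R) (f : R -> W)
  : Prop :=
  exists df : R -> W, {within `[0, T], continuous df} /\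
    forall t, t \in `[0, T] -> deriv_in `[0, T] f t (df t).

Section LieGroupCalculus.
Context {R : realType} {n : nat} {G : lieGroupType R n}.

Definition ltrans (g h : G) : G := (g * h)%g.

(* T_p f : T_p G -> T_(f p) G *)
Definition tangent_map (f : G -> G) (p : G) (v : 'rV[R]_n) : 'rV[R]_n :=
  'd (chart (f p) \o f \o chart_inv p) (chart p p) v.

(* T*_p f : T*_(f p) G -> T*_p G *)
Definition cotangent_map (f : G -> G) (p : G) : 'cV[R]_n -> 'cV[R]_n :=
  dual_map (tangent_map f p).

Definition differential (f : G -> R) (p : G) : 'cV[R]_n :=
  covector (f \o chart_inv p) (chart p p).

(* The left-invariant vector field extending xi, read in the chart at 1. *)
Definition left_field (xi x : 'rV[R]_n) : 'rV[R]_n :=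
  'd (chart (1%g : G) \o ltrans (chart_inv (1%g : G) x)
        \o chart_inv (1%g : G)) (chart (1%g : G) 1%g) xi.

(* The value at 1 of the Lie bracket of the left-invariant vector fields
   extending xi and eta: in coordinates [X, Y] = DY.X - DX.Y. *)
Definition lie_bracket (xi eta : 'rV[R]_n) : 'rV[R]_n :=
  'd (left_field eta) (chart (1%g : G) 1%g) xi
  - 'd (left_field xi) (chart (1%g : G) 1%g) eta.

Definition coad (xi : 'rV[R]_n) : 'cV[R]_n -> 'cV[R]_n :=
  dual_map (lie_bracket xi).

Definition velocity (A : set R) (c : R -> G) (t : R) (v : 'rV[R]_n) : Prop :=
  c @ within A (nbhs t) --> c t /\ deriv_in A (chart (c t) \o c) t v.

(* c in C^1([0, T], G): around each t0, the coordinate expression of c in the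
   chart at c t0 is differentiable, with derivative continuous at t0. *)
Definition C1_curve (T : R) (c : R -> G) : Prop :=
  forall t0, t0 \in `[0, T] ->
  c @ within `[0, T] (nbhs t0) --> c t0 /\
  exists2 dc : R -> 'rV[R]_n,
    \forall t \near within `[0, T] (nbhs t0),
      deriv_in `[0, T] (chart (c t0) \o c) t (dc t) &
    dc @ within `[0, T] (nbhs t0) --> dc t0.

Definition C1_pair (V : G -> G -> R) : Prop :=
  forall p q : G,
  Ck 1 (fun x : 'rV[R]_n * 'rV[R]_n =>
          V (chart_inv p x.1) (chart_inv q x.2))
       [set x | (chart p @` chart_dom p) x.1 /\
                (chart q @` chart_dom q) x.2].

End LieGroupCalculus.

Section MultiAgent.
Context {R : realType} {n r : nat} {G : lieGroupType R n}.
Implicit Types (C : 'I_r -> G -> 'rV[R]_n -> R) (V : 'I_r -> 'I_r -> G -> G -> R).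
Implicit Types (E : rel 'I_r) (T a : R).

Definition total_cost C (g : 'I_r -> G) (u : 'I_r -> 'rV[R]_n) : R :=
  \sum_i C i (g i) (u i).

Definition reduced_potential V (i j : 'I_r) (h : G) : R := V i j 1%g h.

Definition partial_u C (i : 'I_r) (g : G) (u : 'rV[R]_n) : 'cV[R]_n :=
  covector (C i g) u.

(* [lg i] is a covector at [g i] *)
Definition lagrangian E C V (g : 'I_r -> G) (u : 'I_r -> 'rV[R]_n)
    (lg : 'I_r -> 'cV[R]_n) : R :=
  total_cost C g u +
  \sum_i (pairing (lg i) (tangent_map (ltrans (g i)) 1%g (u i))
          + 2^-1 * \sum_(j | E i j) V i j (g i) (g j)).

(* lambda_(g_i) = T*_(g_i) L_(g_i^-1) (lambda_i) *)
Definition translated_multiplier (g : 'I_r -> G) (l : 'I_r -> 'cV[R]_n)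
    (i : 'I_r) : 'cV[R]_n :=
  cotangent_map (ltrans (g i)^-1%g) (g i) (l i).

Definition action E C V T (g : 'I_r -> R -> G) (u : 'I_r -> R -> 'rV[R]_n)
    (l : 'I_r -> R -> 'cV[R]_n) : R :=
  \int[lebesgue_measure]_(t in `[0, T])
    lagrangian E C V (g ^~ t) (u ^~ t)
      (translated_multiplier (g ^~ t) (l ^~ t)).

Definition strip a T : set (R * R) :=
  [set x | `|x.1| < a /\ x.2 \in `[0, T]].

(* A family [(gam eps, om eps)], |eps| < a, of curves through (g, u), for one
   agent.  [dgam eps t] is the derivative of gam in eps, in the tangent space
   at [gam eps t], and [eta eps t] its left translate to the Lie algebra, so
   that delta g = [dgam 0] and eta = [eta 0].  Continuity of [eta] in
   (eps, t) expresses that of [dgam] as a map into the tangent bundle.  The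
   last field is the formula for the induced variation of the control. *)
Record agent_variation a T (g : R -> G) (u : R -> 'rV[R]_n)
    (gam : R -> R -> G) (om : R -> R -> 'rV[R]_n)
    (dgam eta dom : R -> R -> 'rV[R]_n) (deta : R -> 'rV[R]_n) : Prop := {
  var_g0 : forall t, t \in `[0, T] -> gam 0 t = g t;
  var_u0 : forall t, t \in `[0, T] -> om 0 t = u t;
  var_gam_cont :
    {within strip a T, continuous (fun x : R * R => gam x.1 x.2)};
  var_om_cont :
    {within strip a T, continuous (fun x : R * R => om x.1 x.2)};
  var_dgam : forall eps t, strip a T (eps, t) ->
    velocity setT (gam ^~ t) eps (dgam eps t);
  var_eta : forall eps t, strip a T (eps, t) ->
    eta eps t = tangent_map (ltrans (gam eps t)^-1%g) (gam eps t) (dgam eps t);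
  var_eta_cont :
    {within strip a T, continuous (fun x : R * R => eta x.1 x.2)};
  var_dom : forall eps t, strip a T (eps, t) ->
    is_derive eps 1 (om ^~ t) (dom eps t);
  var_dom_cont :
    {within strip a T, continuous (fun x : R * R => dom x.1 x.2)};
  var_ends : dgam 0 0 = 0 /\ dgam 0 T = 0;
  var_deta : forall t, t \in `[0, T] -> deriv_in `[0, T] (eta 0) t (deta t);
  var_deta_cont : {within `[0, T], continuous deta};
  var_induced : forall t, t \in `[0, T] ->
    dom 0 t = deta t + lie_bracket (G := G) (u t) (eta 0 t)
}.

Definition variation T (g : 'I_r -> R -> G) (u : 'I_r -> R -> 'rV[R]_n)
    (gam : R -> 'I_r -> R -> G) (om : R -> 'I_r -> R -> 'rV[R]_n) : Prop :=
  exists2 a : R, 0 < a &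
  forall i, exists dgam eta dom deta,
    agent_variation a T (g i) (u i) (fun eps => gam eps i)
      (fun eps => om eps i) dgam eta dom deta.

Definition stationary E C V T (g : 'I_r -> R -> G) (u : 'I_r -> R -> 'rV[R]_n)
    (l : 'I_r -> R -> 'cV[R]_n) : Prop :=
  forall gam om, variation T g u gam om ->
    is_derive (0 : R) (1 : R)
      (fun eps => action E C V T (gam eps) (om eps) l : R) 0.

(* Admissible curves of the control problem with m actuated directions
   e_0, ..., e_(m-1), boundary values gini, gfin and controls
   u_i = \sum_(k < m) uc_i^k e_k. *)
Record admissible (m : nat) (e : 'I_n -> 'rV[R]_n) T
    (gini gfin : 'I_r -> G) (g : 'I_r -> R -> G)
    (u : 'I_r -> R -> 'rV[R]_n) : Prop := {
  adm_C1 : forall i, C1_curve T (g i);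
  adm_kinematics : forall i t, t \in `[0, T] ->
    velocity `[0, T] (g i) t (tangent_map (ltrans (g i t)) 1%g (u i t));
  adm_control : exists uc : 'I_r -> 'I_n -> R -> R,
    forall i t, t \in `[0, T] ->
      u i t = \sum_(k < n | (k < m)%N) uc i k t *: e k;
  adm_init : forall i, g i 0 = gini i;
  adm_final : forall i, g i T = gfin i
}.

Record multiplier (m : nat) (estar : 'I_n -> 'cV[R]_n) T
    (l : 'I_r -> R -> 'cV[R]_n) : Prop := {
  mult_C1 : forall i, C1_on T (l i);
  mult_form : exists lc : 'I_r -> 'I_n -> R -> R,
    forall i t, t \in `[0, T] ->
      l i t = \sum_(k < n | (m <= k)%N) lc i k t *: estar k
}.

Record extremal E C V (m : nat) (e : 'I_n -> 'rV[R]_n)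
    (estar : 'I_n -> 'cV[R]_n) T (gini gfin : 'I_r -> G)
    (g : 'I_r -> R -> G) (u : 'I_r -> R -> 'rV[R]_n)
    (l : 'I_r -> R -> 'cV[R]_n) : Prop := {
  ext_admissible : admissible m e T gini gfin g u;
  ext_multiplier : multiplier m estar T l;
  ext_stationary : stationary E C V T g u l
}.

End MultiAgent.

(* Main.v *)
Require Import Defs.
From HB Require Import structures.
From mathcomp Require Import all_boot all_order all_algebra.
From mathcomp Require Import all_classical all_reals all_analysis.
From mathcomp Require Import ring.
Set Implicit Arguments.
Unset Strict Implicit.
Unset Printing Implicit Defensive.
Import Order.TTheory GRing.Theory Num.Theory.
Import numFieldNormedType.Exports.
Local Open Scope classical_set_scope.
Local Open Scope ring_scope.

(* For an agent [i] and a test curve [h] in the Lie algebra vanishing at both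
   ends, perturb the trajectory to [g_i(t) exp(eps h(t))] (the inverse of a
   chart at the identity may replace [exp]) and the control accordingly, with
   [delta u_i = h' + [u_i, h]].  The left translate of [delta g_i] is then [h];
   by left invariance the integrand depends on [eps] only through the perturbed
   control and through [V_ij(exp(eps h), g_i^-1 g_j)], while the multiplier term
   reduces to [<lambda_i, u_i>].  Since the potentials are symmetric, the factor
   1/2 disappears from the terms involving agent [i].  Differentiating under the
   integral sign, stationarity reads
     \int <p, h'> + <ad*_u p + w, h> = 0,   p = dC_i/du_i + lambda_i,
   with [w] the sum of the translated forces, and the lemma of Du Bois-Reymond
   yields that [p] is differentiable with [p' = ad*_u p + w].  All integrands
   are continuous because the control, being the body velocity of a C^1 curve,
   is continuous. *)

(** * Derivatives relative to a set of times *)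

Section DerivIn.
Context {R : realType}.
Implicit Types (A : set R) (t : R).

(** The momentum [p] is a priori only continuous, since the costs are of class C^1 and the control
    is only known to be continuous. Integrating [<p, h'>] by parts is thus excluded, and the
    differentiability of [p] has to come out of the argument itself. Derivatives are taken relative
    to [0, T] because only one-sided ones exist at its ends. The chart can stand in for the
    exponential because stationarity sees only the first order at [eps = 0], where a straight line
    in the chart at 1 that starts at the identity with velocity [w] also has body velocity [w]. The
    price is that the perturbation exists only for small [eps], with a radius that must serve all
    times at once; hence bounded test curves. It is enough to move one agent along one fixed
    direction of the Lie algebra at a time, which reduces the covector equation to scalar ones. *)

Lemma near_dnbhs_shift t (P : R -> Prop) :
  (\forall s \near t^', P s) <-> (\forall h \near 0^', P (h + t)).
Proof.
rewrite !near_withinE [X in X <-> _](near_shift (0 : R) t) /= subr0.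
have E h : (h + t != t) = (h != 0) by rewrite -subr_eq0 addrK.
by split; apply: filterS => h /=; rewrite E.
Qed.

Lemma deriv_inP (W : normedModType R) A (f : R -> W) t v :
  deriv_in A f t v <-> forall e, 0 < e ->
   \forall s \near t^', A s -> `|v - (s - t)^-1 *: (f s - f t)| <= e.
Proof.
rewrite /deriv_in; split.
- by move=> /cvgrPdist_le H e /H; rewrite near_withinE.
- by move=> H; apply/cvgrPdist_le => e /H; rewrite near_withinE.
Qed.

Lemma is_deriveP (W : normedModType R) (f : R -> W) t v :
  is_derive t 1 f v <-> deriv_in setT f t v.
Proof.
rewrite deriv_inP; split.
- move=> [dv <-] e e0; move/cvgrPdist_le : (dv) => /(_ _ e0) H.
  apply/near_dnbhs_shift; near=> h => _.
  have : `|lim (h^-1 *: ((f \o shift t) (h *: 1) - f t) @[h --> 0^'])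
    - h^-1 *: ((f \o shift t) (h *: 1) - f t)| <= e by near: h.
  by rewrite /= addrK [h *: 1]mulr1.
- move=> H; have K : (h^-1 *: ((f \o shift t) (h *: (1:R)) - f t) @[h --> 0^'])
     --> v.
    apply/cvgrPdist_le => e /H /near_dnbhs_shift; apply: filterS => h /(_ I).
    by rewrite /= addrK [h *: 1]mulr1.
  by split; [apply/cvg_ex; exists v | apply/cvg_lim].
Unshelve. all: by end_near. Qed.

Lemma deriv_inW (W : normedModType R) A B (f : R -> W) t v :
  B `<=` A -> deriv_in A f t v -> deriv_in B f t v.
Proof.
move=> BA /deriv_inP H; apply/deriv_inP => e /H; apply: filterS => s Hs /BA.
exact: Hs.
Qed.

Lemma is_derive_deriv_in (W : normedModType R) A (f : R -> W) t v :
  is_derive t 1 f v -> deriv_in A f t v.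
Proof. by move/is_deriveP; exact: deriv_inW. Qed.

Lemma eq_deriv_in (W : normedModType R) A (f h : R -> W) t v :
  (forall s, A s -> f s = h s) -> A t -> deriv_in A f t v -> deriv_in A h t v.
Proof.
move=> fh At /deriv_inP H; apply/deriv_inP => e /H; apply: filterS => s Hs As.
by rewrite -!fh//; exact: Hs.
Qed.

Lemma near_eq_deriv_in (W : normedModType R) A (f h : R -> W) t v :
  (\forall s \near within A (nbhs t), f s = h s) -> A t ->
  deriv_in A f t v -> deriv_in A h t v.
Proof.
rewrite near_withinE => fh At /deriv_inP H; apply/deriv_inP => e /H.
have fht := nbhs_singleton fh At.
rewrite !near_withinE; apply: filterS2 fh => s fhs Hs /Hs {}Hs As.
by rewrite -fhs// -fht; exact: Hs.
Qed.

(* Continuing [f] off [A] by its tangent line turns a derivative relative to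
   [A] into an ordinary one, so that the usual calculus rules apply. *)
Definition tangent_extension (W : normedModType R) A (f : R -> W) t v s :=
  if s \in A then f s else f t + (s - t) *: v.

Lemma tangent_extensionE (W : normedModType R) A (f : R -> W) t v s :
  A s -> tangent_extension A f t v s = f s.
Proof. by move=> /mem_set As; rewrite /tangent_extension As. Qed.

Lemma is_derive_tangent_extension (W : normedModType R) A (f : R -> W) t v :
  A t -> deriv_in A f t v -> is_derive t 1 (tangent_extension A f t v) v.
Proof.
move=> At /deriv_inP H; apply/is_deriveP/deriv_inP => e e0.
have := H _ e0; rewrite !near_withinE; apply: filterS => s Hs st _.
rewrite [tangent_extension _ _ _ _ t]tangent_extensionE// /tangent_extension.
case: ifPn => [/set_mem|_]; first exact: Hs.
by rewrite addrAC subrr add0r scalerA mulVf ?subr_eq0// scale1r subrr normr0 ltW.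
Qed.

Lemma deriv_in_comp (V W : normedModType R) A (f : R -> V) (phi : V -> W) t v :
  A t -> deriv_in A f t v -> differentiable phi (f t) ->
  deriv_in A (phi \o f) t ('D_v phi (f t)).
Proof.
move=> At dF dphi.
have := is_derive_tangent_extension At dF.
set F := tangent_extension _ _ _ _ => -[dF1 dFv].
have FE : F t = f t by exact: tangent_extensionE.
have dFt : differentiable F t by apply/derivable1_diffP.
apply: (@eq_deriv_in _ _ (phi \o F)) => //.
  by move=> s As; rewrite /= /F tangent_extensionE.
apply: is_derive_deriv_in; split.
  by apply/derivable1_diffP/differentiable_comp => //; rewrite FE.
rewrite deriveE; last by apply: differentiable_comp => //; rewrite FE.
by rewrite diff_comp ?FE//= -[in RHS]dFv (deriveE _ dFt) deriveE.
Qed.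

Lemma deriv_in_continuous (W : normedModType R) A (f : R -> W) t v :
  A t -> deriv_in A f t v -> f @ within A (nbhs t) --> f t.
Proof.
move=> At dF; have [dF1 _] := is_derive_tangent_extension At dF.
have /differentiable_continuous : differentiable (tangent_extension A f t v) t.
  exact/derivable1_diffP.
rewrite /prop_for /continuous_at tangent_extensionE// => /cvg_within_filter.
move=> /(_ A); apply: cvg_trans; apply: near_eq_cvg.
by rewrite near_withinE; near=> s => As; rewrite tangent_extensionE.
Unshelve. all: by end_near. Qed.

Lemma deriv_inZl (W : normedModType R) A (f : R -> R) (t d : R) (w : W) :
  deriv_in A f t d -> deriv_in A (fun s => f s *: w) t (d *: w).
Proof.
move=> df; rewrite /deriv_in.
rewrite (_ : (fun s => _) = (fun s => ((s - t)^-1 *: (f s - f t) : R) *: w)).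
  by apply: cvgZ; [exact: df|exact: cvg_cst].
by apply/funext => s; rewrite -scalerBl scalerA.
Qed.

(** A segment of positive length has no isolated point, so the filter defining the relative
    derivative is proper and its limits are unique. The nearby point is sought to the right of [t],
    and to the left only when [t = T]. *)
Lemma deriv_in_segment_unique (W : normedModType R) T (f : R -> W) t v w :
  0 < T -> t \in `[0, T] -> deriv_in `[0, T] f t v -> deriv_in `[0, T] f t w ->
  v = w.
Proof.
move=> T0 tT; rewrite /deriv_in.
suff PF : ProperFilter (within `[0, T] t^') by exact: cvg_unique.
apply: Build_ProperFilter_ex => P; rewrite /within /= near_withinE.
move=> /nbhs_ballP[e /= e0 He].
move: tT; rewrite in_itv /= => /andP[t0 tT].
have [tT1|Tt] := ltP t T.
- pose d := Num.min (e / 2) (T - t).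
  have d0 : 0 < d by rewrite lt_min subr_gt0 tT1 divr_gt0.
  exists (t + d); apply: He => /=.
  + rewrite /ball /= opprD addNKr normrN gtr0_norm//.
    by rewrite (@le_lt_trans _ _ (e / 2)) ?ge_min ?lexx// ltr_pdivrMr// ltr_pMr// ltr1n.
  + by rewrite -subr_eq0 addrAC subrr add0r gt_eqF.
  + by rewrite in_itv /= addr_ge0 ?(ltW d0)//= addrC -lerBrDr ge_min lexx orbT.
- have {Tt tT} tE : t = T by apply/eqP; rewrite eq_le tT Tt.
  pose d := Num.min (e / 2) T.
  have d0 : 0 < d by rewrite lt_min T0 divr_gt0.
  exists (t - d); apply: He => /=.
  + rewrite /ball /= opprB addrCA subrr addr0 gtr0_norm//.
    by rewrite (@le_lt_trans _ _ (e / 2)) ?ge_min ?lexx// ltr_pdivrMr// ltr_pMr// ltr1n.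
  + by rewrite -subr_eq0 addrAC subrr add0r oppr_eq0 gt_eqF.
  + by rewrite in_itv /= tE subr_ge0 gerBl (ltW d0) andbT ge_min lexx orbT.
Qed.

End DerivIn.

(** * Integration on a segment *)

Section Integrals.
Context {R : realType}.
Notation mu := (@lebesgue_measure R).
Implicit Types (T : R) (f p q : R -> R).

Lemma continuous_integrable f a b : continuous f ->
  mu.-integrable `[a, b] (EFin \o f).
Proof.
move=> cf; apply: continuous_compact_integrable; first exact: segment_compact.
exact: continuous_subspaceT.
Qed.

Lemma ex_primitive f T : continuous f ->
  exists F : R -> R, forall t, t \in `[0, T] -> is_derive t 1 F (f t).
Proof.
(* Integrating from -1, within an interval reaching to [T + 1], puts 0 and [T] in the interior, so
   that the derivative is two-sided there as well. *)
move=> cf; exists (fun x => \int[mu]_(t in `[-1, x]) f t) => t.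
rewrite in_itv /= => /andP[t0 tT].
have tT1 : t < T + 1 by rewrite (le_lt_trans tT)// ltrDl.
have t1 : -1 < t by rewrite (lt_le_trans _ t0)// ltrN10.
have [dF FE] := continuous_FTC1_closed tT1 (continuous_integrable _ _ cf) t1 (cf t).
by apply: DeriveDef; [exact: dF|rewrite -derive1E; exact: FE].
Qed.

Lemma Rintegral_primitive f (F : R -> R) T : 0 < T -> continuous f ->
  (forall t, t \in `[0, T] -> is_derive t 1 F (f t)) ->
  \int[mu]_(t in `[0, T]) f t = F T - F 0.
Proof.
move=> T0 cf dF.
have dF1 : {in `[0, T], forall t : R, derivable F t 1}.
  by move=> t /dF [].
have cF t : t \in `[0, T] -> {for t, continuous F}.
  by move=> /dF1 /derivable1_diffP /differentiable_continuous.
rewrite /Rintegral (@continuous_FTC2 _ f F)//.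
- exact: continuous_subspaceT.
- split.
  + by move=> t /subset_itv_oo_cc /dF1.
  + by apply: cvg_at_right_filter; apply: cF; rewrite in_itv /= lexx ltW.
  + by apply: cvg_at_left_filter; apply: cF; rewrite in_itv /= lexx ltW.
- by move=> t /subset_itv_oo_cc /dF [_ <-]; rewrite derive1E.
Qed.

Lemma RintegralD_continuous f h a b : continuous f -> continuous h ->
  \int[mu]_(t in `[a, b]) (f t + h t)
  = \int[mu]_(t in `[a, b]) f t + \int[mu]_(t in `[a, b]) h t.
Proof. by move=> cf ch; rewrite RintegralD//; exact: continuous_integrable. Qed.

(** A primitive of [f^2] is nondecreasing and takes equal values at 0 and [T], so it is constant on
    the segment; uniqueness of the relative derivative, endpoints included, then gives [f^2 = 0]. *)
Lemma square_integral_eq0 f T : 0 < T -> continuous f ->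
  \int[mu]_(t in `[0, T]) (f t * f t) = 0 -> forall t, t \in `[0, T] -> f t = 0.
Proof.
move=> T0 cf; have cff : continuous (fun t => f t * f t).
  by move=> x; apply: continuousM; exact: cf.
have [S dS] := ex_primitive T cff.
rewrite (Rintegral_primitive T0 cff dS) => /eqP; rewrite subr_eq0 => /eqP ST t tT.
have dS1 : {in `[0, T], forall t : R, derivable S t 1}.
  by move=> s /dS [].
have mono : {in `[0, T] &, {homo S : x y / x <= y}}.
  apply: ger0_derive1_le_cc.
  - by move=> s /subset_itv_oo_cc /dS1.
  - by move=> s /subset_itv_oo_cc /dS [_]; rewrite derive1E => ->; rewrite -expr2 sqr_ge0.
  - exact: derivable_within_continuous.
have i0 : 0 \in `[0, T] by rewrite in_itv /= lexx ltW.
have iT : T \in `[0, T] by rewrite in_itv /= lexx ltW.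
have SE s : s \in `[0, T] -> S s = S 0.
  move=> sT; have := sT; rewrite in_itv /= => /andP[s0 s1].
  by apply/eqP; rewrite eq_le (mono _ _ i0 sT s0) andbT -ST (mono _ _ sT iT s1).
have H1 := is_derive_deriv_in `[0, T] (dS _ tT).
have H2 : deriv_in `[0, T] S t 0.
  apply: (@eq_deriv_in _ _ _ (cst (S 0))) => //; first by move=> s /SE ->.
  exact: is_derive_deriv_in.
have := deriv_in_segment_unique T0 tT H1 H2.
by move=> /eqP; rewrite mulf_eq0 orbb => /eqP.
Qed.

(** A continuous retraction of the line onto the segment: composing with it freezes a function at
    its end values and turns continuity on [0, T] into continuity everywhere. *)
Definition clamp T t : R := Num.max 0 (Num.min t T).

Lemma clampE T t : t \in `[0, T] -> clamp T t = t.
Proof.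
by rewrite in_itv /= /clamp => /andP[t0 tT]; rewrite min_l// max_r.
Qed.

Lemma clamp_itv T t : 0 <= T -> clamp T t \in `[0, T].
Proof.
by move=> T0; rewrite in_itv /= /clamp le_max lexx /= ge_max T0 ge_min lexx orbT.
Qed.

Lemma clamp_continuous T : continuous (clamp T).
Proof.
have -> : clamp T = (fun=> 0 : R^o) \max ((id : R -> R^o) \min (fun=> T)) by [].
move=> t; apply: (@continuous_max R R (fun=> 0) _ t); first exact: cvg_cst.
by apply: (@continuous_min R R id (fun=> T) t); [exact: cvg_id|exact: cvg_cst].
Qed.

Lemma continuous_clamp_comp T (U : topologicalType) (f : R -> U) : 0 <= T ->
  {within `[0, T], continuous f} -> continuous (f \o clamp T).
Proof.
move=> T0 /subspace_continuousP cf t B Bf.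
have H : nbhs t (clamp T @^-1` (fun s => s \in `[0, T] -> B (f s))).
  exact: (@clamp_continuous T t _ (cf _ (clamp_itv t T0) B Bf)).
by apply: filterS H => s /= H; apply: H; exact: clamp_itv.
Qed.

Lemma continuous_compact_bound (U : topologicalType) (W : normedModType R)
    (K : set U) (f : U -> W) : compact K -> {within K, continuous f} ->
  exists H, forall x, K x -> `|f x| <= H.
Proof.
move=> cK cf; have /compact_bounded [M [_ HM]] := continuous_compact cf cK.
by exists (M + 1) => x Kx; apply: (HM (M + 1)); [rewrite ltrDl|exists x].
Qed.

(** Let [Q] be a primitive of [q] and [c] the mean of [p - Q]. The function [phi] with
    [phi' = p - Q - c] and [phi 0 = 0] also vanishes at [T], so it is a legitimate test; and
    [p phi' + q phi] is [phi'^2] plus the derivative of [(Q + c) phi], whose integral is 0. Hence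
    [phi' = 0], and [p = Q + c] has the derivative of [Q]. *)
Lemma du_bois_reymond T p q : 0 < T -> continuous p -> continuous q ->
  (forall phi dphi : R -> R, continuous phi -> continuous dphi ->
     (exists H, forall t, `|phi t| <= H) ->
     (forall t, t \in `[0, T] -> deriv_in `[0, T] phi t (dphi t)) ->
     phi 0 = 0 -> phi T = 0 ->
     \int[mu]_(t in `[0, T]) (p t * dphi t + q t * phi t) = 0) ->
  forall t, t \in `[0, T] -> deriv_in `[0, T] p t (q t).
Proof.
move=> T0 cp cq stat.
have [Q0 dQ0] := ex_primitive T cq.
(* The primitive is controlled on the segment only, while test functions must be continuous on the
   whole line. *)
pose Q := Q0 \o clamp T.
have itv0 : 0 \in `[0, T] by rewrite in_itv /= lexx ltW.
have itvT : T \in `[0, T] by rewrite in_itv /= lexx ltW.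
have prim_cont (f F : R -> R) : (forall t, t \in `[0, T] -> is_derive t 1 F (f t)) ->
    continuous (F \o clamp T).
  move=> dF; apply: continuous_clamp_comp; first exact: ltW.
  by apply: derivable_within_continuous => t /dF [].
have cQ : continuous Q := prim_cont _ _ dQ0.
have cpQ : continuous (fun t => p t - Q t).
  by move=> t; apply: cvgB; [exact: cp|exact: cQ].
have [S dS] := ex_primitive T cpQ.
pose c := (S T - S 0) / T.
pose dphi t := p t - Q t - c.
pose phi0 t := S t - S 0 - c * t.
pose phi := phi0 \o clamp T.
have dphi0 t : t \in `[0, T] -> is_derive t 1 phi0 (dphi t).
  move=> /dS dSt; rewrite /phi0 /dphi.
  have H : is_derive t 1 (fun t => c * t) c.
    by apply: is_derive_eq; rewrite /= [_%:A]mulr1.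
  by apply: is_derive_eq; rewrite subr0.
have cphi : continuous phi := prim_cont _ _ dphi0.
have cdphi : continuous dphi.
  by move=> t; apply: cvgB; [exact: cpQ|exact: cvg_cst].
have phiE t : t \in `[0, T] -> phi t = phi0 t by move=> tT; rewrite /phi /= clampE.
have phi_0 : phi 0 = 0 by rewrite phiE// /phi0 subrr mulr0 subrr.
have phi_T : phi T = 0 by rewrite phiE// /phi0 /c mulfVK ?gt_eqF// subrr.
have dphi_in t : t \in `[0, T] -> deriv_in `[0, T] phi t (dphi t).
  move=> tT; apply: (@eq_deriv_in _ _ _ phi0) => //.
    by move=> s sT; rewrite phiE.
  exact/is_derive_deriv_in/dphi0.
have phi_bound : exists H, forall t, `|phi t| <= H.
  have [] := @continuous_compact_bound R R `[0, T] phi (@segment_compact _ _ _).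
    exact: continuous_subspaceT.
  move=> H HH; exists H => t; rewrite /phi /= -(clampE (clamp_itv t (ltW T0))).
  by apply: HH; exact: clamp_itv (ltW T0).
have {stat} := stat phi dphi cphi cdphi phi_bound dphi_in phi_0 phi_T.
(* The derivative of [(Q + c) phi] on the segment. *)
pose f2 t := q t * phi t + Q t * dphi t + c * dphi t.
have cf2 : continuous f2.
  move=> t; apply: cvgD; first apply: cvgD.
  - by apply: cvgM; [exact: cq|exact: cphi].
  - by apply: cvgM; [exact: cQ|exact: cdphi].
  - by apply: cvgM; [exact: cvg_cst|exact: cdphi].
have cdd : continuous (fun t => dphi t * dphi t).
  by move=> t; apply: continuousM; exact: cdphi.
have If2 : \int[mu]_(t in `[0, T]) f2 t = 0.
  have dF2 t : t \in `[0, T] ->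
      is_derive t 1 (fun t => Q0 t * phi0 t + c * phi0 t) (f2 t).
    move=> tT; have dq := dQ0 _ tT; have dp := dphi0 _ tT.
    rewrite /f2 phiE// /Q /= clampE//.
    have -> : (fun t => Q0 t * phi0 t + c * phi0 t) = Q0 * phi0 + c *: phi0 by [].
    apply: is_derive_eq; rewrite -[LHS]/(Q0 t * dphi t + phi0 t * q t + c * dphi t); ring.
  rewrite (Rintegral_primitive T0 cf2 dF2).
  have := phiE _ itv0; have := phiE _ itvT; rewrite phi_0 phi_T => <- <-.
  by rewrite !mulr0 !addr0 subrr.
rewrite (_ : (fun t => _) = (fun t => dphi t * dphi t + f2 t)); last first.
  by apply/funext => t; rewrite /f2 /dphi; ring.
rewrite RintegralD_continuous// If2 addr0 => /(square_integral_eq0 T0 cdphi) dphi_eq0.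
move=> t tT; apply: (@eq_deriv_in _ _ _ (fun s => Q0 s + c)) => //.
  move=> s sT; have := dphi_eq0 _ sT; rewrite /dphi /Q /= clampE// => /eqP.
  by rewrite subr_eq0 subr_eq addrC => /eqP ->; rewrite addrC.
have dq := dQ0 _ tT.
apply: is_derive_deriv_in.
have -> : (fun s => Q0 s + c) = Q0 + cst c by [].
by apply: is_derive_eq; rewrite addr0.
Qed.
End Integrals.

(** * Differentiation under the integral sign *)

Section Leibniz.
Context {R : realType}.
Notation mu := (@lebesgue_measure R).

(** Dominated differentiation: the rectangle [|eps| <= a / 2], [t] in [0, T], is a compact part of
    the strip, so the continuous [dF] is bounded on it, and a constant is integrable over the
    segment. *)
Lemma is_derive_under_integral (T a : R) (F dF : R -> R -> R) : 0 < a ->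
  (forall eps, `|eps| < a -> {within `[0, T], continuous (F eps)}) ->
  (forall eps t, strip a T (eps, t) -> is_derive eps 1 (F ^~ t) (dF eps t)) ->
  {within strip a T, continuous (fun x : R * R => dF x.1 x.2)} ->
  is_derive (0 : R) (1 : R) (fun eps => \int[mu]_(t in `[0, T]) F eps t)
    (\int[mu]_(t in `[0, T]) dF 0 t).
Proof.
move=> a0 cF derF cdF.
pose b := a / 2.
have b0 : 0 < b by rewrite divr_gt0.
have ba : b < a by rewrite /b ltr_pdivrMr// ltr_pMr// ltr1n.
pose K := `[- b, b] `*` `[0, T].
have Kstrip : K `<=` strip a T.
  move=> [x t] [/= ]; rewrite in_itv /= -ler_norml => xb tT.
  by split => //=; rewrite (le_lt_trans xb).
have cK : compact K by apply: compact_setX; exact: segment_compact.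
have [H HH] := continuous_compact_bound cK (continuous_subspaceW Kstrip cdF).
have Ib x : `]- b, b[%classic x -> `|x| < a.
  by rewrite /= in_itv /= -ltr_norml => /lt_trans; exact.
have st x t : `]- b, b[%classic x -> `[0, T]%classic t -> strip a T (x, t).
  by move=> /Ib xa tT; split.
have E x t : `]- b, b[%classic x -> `[0, T]%classic t -> partial1of2 F x t = dF x t.
  by move=> xb tT; have [_ <-] := derF _ _ (st _ _ xb tT); rewrite partial1of2E.
have I0 : `]- b, b[%classic (0 : R) by rewrite /= in_itv /= oppr_lt0 b0.
have mT : measurable `[0, T] by exact: measurable_itv.
have := @cvg_differentiation_under_integral R _ _ mu F `[0, T] mT 0 (- b) b I0.
(* A dominating function must be nonnegative, whereas [H] is merely some upper bound. *)
move=> /(_ _ _ (fun=> Num.max 0 H)) L.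
have {L} : h^-1 *: ((\int[mu]_(t in `[0, T]) F (h + 0) t)
    - (\int[mu]_(t in `[0, T]) F 0 t)) @[h --> 0^'] -->
   \int[mu]_(y in `[0, T]) partial1of2 F 0 y.
  apply: L.
  - move=> x xb; apply: continuous_compact_integrable; first exact: segment_compact.
    exact/cF/Ib.
  - by move=> x t xb tT; have [] := derF _ _ (st _ _ xb tT).
  - by move=> _; rewrite le_max lexx.
  - by apply: (@continuous_integrable R (fun=> _)) => t; exact: cvg_cst.
  - move=> x t xb tT; rewrite E// le_max; apply/orP; right.
    apply: (HH (x, t)); split => //=.
    by move: xb; rewrite /= !in_itv /= => /andP[/ltW -> /ltW ->].
rewrite (_ : \int[mu]_(y in `[0, T]) partial1of2 F 0 y =
   \int[mu]_(t in `[0, T]) dF 0 t); last first.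
  by apply: eq_Rintegral => t; rewrite inE => tT; rewrite E.
move=> L.
have {}L : (h^-1 *:
    (((fun eps => \int[mu]_(t in `[0, T]) F eps t) \o shift 0) (h *: (1 : R))
    - (\int[mu]_(t in `[0, T]) F 0 t)) @[h --> 0^']) -->
   \int[mu]_(t in `[0, T]) dF 0 t.
  by under eq_fun do rewrite /= [_%:A]mulr1.
by apply: DeriveDef; [apply/cvg_ex; eexists; exact: L | exact/cvg_lim].
Qed.
End Leibniz.

(** * Differentiable maps into a Lie group *)

Section NearEq.
Context {R : realType} {V W : normedModType R}.

Lemma near_eq_differentiable (f g : V -> W) (x : V) : (\near x, f x = g x) ->
  differentiable f x -> differentiable g x.
Proof.
move=> fg df; have [cdf /eqaddoP H] := (diff_locallyP x f).1 df.
have E : g \o shift x = cst (g x) + 'd f x +o_ 0 id.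
  apply/eqaddoP => e e0; have := H _ e0.
  rewrite -(nbhs_singleton fg).
  have := fg; rewrite (near_shift (0 : V) x) /= subr0 => fg0.
  by apply: filterS2 fg0 => y fgy; rewrite /= ![(_ - _) y]/(_ - _) /= fgy.
have D := diff_unique cdf E.
by apply/diff_locallyP; rewrite D; split; [exact: cdf|exact: E].
Qed.

Lemma derive_linear (f : V -> W) (x : V) : differentiable f x ->
  linear (fun v => 'D_v f x).
Proof. by move=> df a u v; rewrite !deriveE// linearP. Qed.

Lemma derive_comp (U : normedModType R) (f : V -> W) (g : W -> U) (x v : V) :
  differentiable f x -> differentiable g (f x) ->
  'D_v (g \o f) x = 'D_('D_v f x) g (f x).
Proof.
move=> df dg; rewrite !deriveE//; last exact: differentiable_comp.
by rewrite diff_comp.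
Qed.

End NearEq.

Section Charts.
Context {R : realType} {n : nat} {G : lieGroupType R n}.
Implicit Types (p q g h : G) (V : normedModType R).

Definition chart_img p : set 'rV[R]_n := chart p @` chart_dom p.

Lemma chart_img_center p : chart_img p (chart p p).
Proof. by exists p => //; exact: chart_dom_center. Qed.

Lemma chart_cK p : chart_inv p (chart p p) = p.
Proof. by apply: chartK; exact: chart_dom_center. Qed.

Lemma chart_invK p x : chart_img p x -> chart p (chart_inv p x) = x.
Proof. by move=> [q pq <-]; rewrite chartK. Qed.

Lemma chart_inv_dom p x : chart_img p x -> chart_dom p (chart_inv p x).
Proof. by move=> [q pq <-]; rewrite chartK. Qed.

Lemma near_chart_img p x : chart_img p x -> \forall y \near x, chart_img p y.
Proof. by move=> px; apply: open_nbhs_nbhs; split => //; exact: chart_img_open. Qed.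

Lemma near_chart_dom p q : chart_dom p q -> \forall h \near q, chart_dom p h.
Proof. by move=> px; apply: open_nbhs_nbhs; split => //; exact: chart_dom_open. Qed.

Lemma cvg_mulg (T : Type) (F : set_system T) {FF : Filter F} (f k : T -> G) a b :
  f @ F --> a -> k @ F --> b -> (fun t => f t * k t)%g @ F --> (a * b)%g.
Proof.
move=> fa kb; apply: (@cvg_comp _ _ _ (fun t => (f t, k t)) (fun x => x.1 * x.2)%g).
  exact: cvg_pair fa kb.
exact: (@lie_mul_continuous R n G (a, b)).
Qed.

Lemma cvg_invg (T : Type) (F : set_system T) {FF : Filter F} (f : T -> G) a :
  f @ F --> a -> (fun t => (f t)^-1)%g @ F --> (a^-1)%g.
Proof. by move=> fa; apply: (cvg_comp _ _ fa); exact: lie_inv_continuous. Qed.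

(** Differentiability of a map into the group, tested in the chart at the image point. Continuity is
    a separate clause because the chart says nothing about points outside its domain. *)
Definition mdiff V (f : V -> G) (x : V) : Prop :=
  f @ x --> f x /\ differentiable (chart (f x) \o f) x.

(** Transition maps are smooth, so the chart at the image point may be exchanged for any chart
    around it. *)
Lemma mdiff_chart V (f : V -> G) x p : mdiff f x -> chart_dom p (f x) ->
  differentiable (chart p \o f) x.
Proof.
move=> [cf df] pfx.
apply: (@near_eq_differentiable _ _ _
  ((chart p \o chart_inv (f x)) \o (chart (f x) \o f)) _ x _ _).
  have : \forall y \near x, chart_dom (f x) (f y).
    by apply: cf; apply: near_chart_dom; exact: chart_dom_center.
  by apply: filterS => y dy; rewrite /= chartK.
apply: differentiable_comp df _ => /=.
have [+ _] := @chart_transition R n G (f x) p 1; apply.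
by exists (f x) => //; split => //; exact: chart_dom_center.
Qed.

Lemma mdiff_cst V (g : G) (x : V) : mdiff (fun=> g) x.
Proof.
split; first exact: cvg_cst.
by rewrite (_ : _ \o _ = cst (chart g g))//; exact: differentiable_cst.
Qed.

Lemma mdiff_chart_inv p x : chart_img p x -> mdiff (chart_inv p) x.
Proof.
move=> px; have pq := chart_inv_dom px; split.
  by case: px => q dq <-; exact: chart_inv_continuous.
have [+ _] := @chart_transition R n G p (chart_inv p x) 1; apply.
exists (chart_inv p x); last exact: chart_invK.
by split => //; exact: chart_dom_center.
Qed.

Lemma mdiff_comp (U V : normedModType R) (phi : U -> V) (f : V -> G) x :
  differentiable phi x -> mdiff f (phi x) -> mdiff (f \o phi) x.
Proof.
move=> dphi [cf df]; split.
  by apply: cvg_comp cf; exact: differentiable_continuous.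
exact: (@differentiable_comp _ _ _ _ phi (chart (f (phi x)) \o f)).
Qed.

Definition mulc p q (x : 'rV[R]_n * 'rV[R]_n) : 'rV[R]_n :=
  chart (p * q)%g (chart_inv p x.1 * chart_inv q x.2)%g.

Definition mulc_dom p q (x : 'rV[R]_n * 'rV[R]_n) : Prop :=
  [/\ chart_img p x.1, chart_img q x.2 &
      chart_dom (p * q)%g (chart_inv p x.1 * chart_inv q x.2)%g].

Lemma mulc_differentiable p q x : mulc_dom p q x -> differentiable (mulc p q) x.
Proof. by move=> xpq; have [+ _] := @lie_mul_smooth R n G p q 1; apply. Qed.

Lemma mulc_derive_continuous p q x v : mulc_dom p q x ->
  {for x, continuous ('D_v (mulc p q))}.
Proof. by move=> xpq; have [_ /(_ v)] := @lie_mul_smooth R n G p q 1; apply. Qed.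

(** Left-invariant fields are first derivatives of the product and the bracket differentiates them
    once more, hence the appeal to second order smoothness. *)
Lemma mulc_derive_differentiable p q x v : mulc_dom p q x ->
  differentiable ('D_v (mulc p q)) x.
Proof. by move=> xpq; have [_ /(_ v) [+ _]] := @lie_mul_smooth R n G p q 2; apply. Qed.

Lemma mdiff_mul V (f k : V -> G) x : mdiff f x -> mdiff k x ->
  mdiff (fun y => f y * k y)%g x.
Proof.
move=> [cf df] [ck dk]; split; first exact: cvg_mulg.
pose phi y := ((chart (f x) \o f) y, (chart (k x) \o k) y).
apply: (@near_eq_differentiable _ _ _ (mulc (f x) (k x) \o phi) _ x _ _).
  have Hf : \forall y \near x, chart_dom (f x) (f y).
    by apply: cf; apply: near_chart_dom; exact: chart_dom_center.
  have Hk : \forall y \near x, chart_dom (k x) (k y).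
    by apply: ck; apply: near_chart_dom; exact: chart_dom_center.
  by apply: filterS2 Hf Hk => y fy ky; rewrite /mulc /= !chartK.
apply: differentiable_comp; first exact: (differentiable_pair df dk).
apply: mulc_differentiable; split => /=; try exact: chart_img_center.
by rewrite !chart_cK; exact: chart_dom_center.
Qed.

Lemma tangent_map_derive (phi : G -> G) p v :
  mdiff (phi \o chart_inv p) (chart p p) ->
  tangent_map phi p v = 'D_v (chart (phi p) \o phi \o chart_inv p) (chart p p).
Proof.
move=> [_]; rewrite /= chart_cK compA => dphi.
by rewrite deriveE// /tangent_map /diff.
Qed.

Lemma tangent_mapE V (f : V -> G) (phi : G -> G) x v : mdiff f x ->
  mdiff (phi \o chart_inv (f x)) (chart (f x) (f x)) ->
  tangent_map phi (f x) ('D_v (chart (f x) \o f) x)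
  = 'D_v (chart (phi (f x)) \o (phi \o f)) x.
Proof.
move=> [cf df] dphi; rewrite tangent_map_derive; last exact: dphi.
case: dphi => _; rewrite /= chart_cK compA => dphi.
rewrite -(derive_comp v df dphi); apply: near_eq_derive.
have : \forall y \near x, chart_dom (f x) (f y).
  by apply: cf; apply: near_chart_dom; exact: chart_dom_center.
by apply: filterS => y dy; rewrite /= chartK.
Qed.

Lemma mdiff_ltrans V (f : V -> G) g x : mdiff f x -> mdiff (ltrans g \o f) x.
Proof. by move=> df; apply: mdiff_mul => //; exact: mdiff_cst. Qed.

Lemma mdiff_ltrans_chart_inv g p x : chart_img p x -> mdiff (ltrans g \o chart_inv p) x.
Proof. by move=> px; apply: mdiff_ltrans; exact: mdiff_chart_inv. Qed.

Lemma tangent_ltrans V (f : V -> G) g x v : mdiff f x ->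
  tangent_map (ltrans g) (f x) ('D_v (chart (f x) \o f) x)
  = 'D_v (chart (g * f x)%g \o (ltrans g \o f)) x.
Proof.
move=> df; rewrite tangent_mapE//.
by apply: mdiff_ltrans_chart_inv; exact: chart_img_center.
Qed.

Lemma derive_chart_chart_inv p x v : chart_img p x ->
  'D_v (chart p \o chart_inv p) x = v.
Proof.
move=> px; transitivity ('D_v (@id 'rV[R]_n) x); last exact: derive_id.
apply: near_eq_derive.
by apply: filterS (near_chart_img px) => y py; rewrite /= chart_invK.
Qed.

(** The chain rule along [ltrans g \o chart_inv 1]: translating this map back by [g^-1] leaves
    [chart_inv 1], which reads as the identity in the chart at 1. *)
Lemma tangent_ltransK g v :
  tangent_map (ltrans g^-1%g) g (tangent_map (ltrans g) 1%g v) = v.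
Proof.
pose f := ltrans g \o chart_inv (1%g : G).
have df : mdiff f (chart (1%g : G) 1%g).
  by apply: mdiff_ltrans_chart_inv; exact: chart_img_center.
have fE : f (chart (1%g : G) 1%g) = g by rewrite /f /= chart_cK /ltrans mulg1.
have := tangent_ltrans g^-1%g v df; rewrite fE mulVg.
rewrite (_ : ltrans g^-1%g \o f = chart_inv 1%g); last first.
  by apply/funext => x; rewrite /f /ltrans /= mulKg.
rewrite derive_chart_chart_inv; last exact: chart_img_center.
move=> H.
have E : tangent_map (ltrans g) 1%g v = 'D_v (chart g \o f) (chart (1%g : G) 1%g).
  rewrite tangent_map_derive; last exact: df.
  by rewrite {1}/ltrans mulg1 -compA.
by rewrite E H.
Qed.

End Charts.

(** * Linear maps on row vectors and limits of directional derivatives *)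

Section Rows.
Context {R : realType} {n : nat}.

Lemma linear_row_expand (W : normedModType R) (L : 'rV[R]_n -> W) (v : 'rV[R]_n) :
  linear L -> L v = \sum_k v 0 k *: L (delta_mx 0 k).
Proof.
move=> hL.
pose hL' := @GRing.isLinear.Build R 'rV[R]_n W *:%R L hL.
pose L' : {linear 'rV[R]_n -> W} := HB.pack L hL'.
transitivity (L' (\sum_k v 0 k *: delta_mx 0 k)); first by rewrite -row_sum_delta.
rewrite linear_sum.
by apply: eq_bigr => k _; rewrite linearZ.
Qed.

Lemma linear_row0 (W : normedModType R) (L : 'rV[R]_n -> W) : linear L -> L 0 = 0.
Proof.
by move=> hL; rewrite (linear_row_expand 0 hL) big1// => k _; rewrite mxE scale0r.
Qed.

Lemma cvg_coord (T : Type) (F : set_system T) {FF : Filter F} m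
    (w : T -> 'M[R]_(m, n)) (w0 : 'M[R]_(m, n)) i j :
  w @ F --> w0 -> (fun t => w t i j) @ F --> w0 i j.
Proof. move=> ww0.
exact: (cvg_comp w (fun M : 'M[R]_(m, n) => M i j) ww0
  (@coord_continuous R m n i j w0)).
Qed.

Lemma cvg_bigsum (W : normedModType R) (I : finType) (P : pred I) (T : Type)
  (F : set_system T) {FF : Filter F} (f : I -> T -> W) (l : I -> W) :
  (forall i, P i -> f i @ F --> l i) ->
  (fun t => \sum_(i | P i) f i t) @ F --> \sum_(i | P i) l i.
Proof.
move=> fl; rewrite (_ : (fun t => _) = \sum_(i | P i) f i); last first.
  by apply/funext => t; rewrite fct_sumE.
elim/big_ind2 : _ => //; first exact: cvg_cst.
by move=> x1 x2 y1 y2; exact: cvgD.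
Qed.

(** Regularity gives continuity of the derivative in each fixed direction; expanding a moving
    direction over the finite basis upgrades this to joint continuity in point and direction. The
    map [iota] lets directions enter through one factor of a product. *)
Lemma cvg_derive (V W : normedModType R) (f : V -> W) (iota : 'rV[R]_n -> V)
    (T : Type) (F : set_system T) {FF : Filter F} (z : T -> V)
    (w : T -> 'rV[R]_n) (z0 : V) (w0 : 'rV[R]_n) :
  linear iota -> z @ F --> z0 -> w @ F --> w0 ->
  (\forall t \near F, differentiable f (z t)) -> differentiable f z0 ->
  (forall v, {for z0, continuous ('D_v f)}) ->
  (fun t => 'D_(iota (w t)) f (z t)) @ F --> 'D_(iota w0) f z0.
Proof.
move=> hi zz0 ww0 df df0 cdf.
have E u x : differentiable f x ->
    'D_(iota u) f x = \sum_k u 0 k *: 'D_(iota (delta_mx 0 k)) f x.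
  move=> dfx; apply: (@linear_row_expand W (fun u => 'D_(iota u) f x)) => a y y'.
  by rewrite hi derive_linear.
rewrite E//.
have : (fun t => \sum_k w t 0 k *: 'D_(iota (delta_mx 0 k)) f (z t)) @ F -->
  \sum_k w0 0 k *: 'D_(iota (delta_mx 0 k)) f z0.
  apply: cvg_bigsum => k _; apply: cvgZ; first exact: cvg_coord.
  exact: (cvg_comp z _ zz0 (cdf _)).
apply: cvg_trans; apply: near_eq_cvg; apply: filterS df => t dft.
by rewrite E.
Qed.

Lemma pair0_linear (V : normedModType R) :
  linear (fun v : 'rV[R]_n => (0, v) : V * 'rV[R]_n).
Proof.
by move=> a x y; rewrite /GRing.scale /= /GRing.add /= /add_pair /= scaler0 addr0.
Qed.

Lemma deriv_in_col A (f : R -> 'cV[R]_n) (t : R) (v : 'cV[R]_n) :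
  (forall k, deriv_in A (fun s => f s k 0) t (v k 0)) -> deriv_in A f t v.
Proof.
move=> H.
have E (x : 'cV[R]_n) : x = \sum_k x k 0 *: (delta_mx k 0 : 'cV[R]_n).
  by rewrite [LHS]matrix_sum_delta; apply: eq_bigr => k _; rewrite big_ord1.
rewrite /deriv_in (E v).
rewrite (_ : (fun s => _) = (fun s => \sum_k ((s - t)^-1 *: (f s k 0 - f t k 0) : R)
   *: (delta_mx k 0 : 'cV[R]_n))).
  apply: cvg_bigsum => k _; apply: cvgZ; [exact: H|exact: cvg_cst].
apply/funext => s; rewrite {1}(E (f s - f t)) scaler_sumr.
by apply: eq_bigr => k _; rewrite scalerA !mxE.
Qed.

End Rows.

(** * The pairing of covectors with vectors *)

Section Pairing.
Context {R : realType} {n : nat}.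

Lemma pairingE (mu : 'cV[R]_n) v : pairing mu v = \sum_k v 0 k * mu k 0.
Proof. by rewrite /pairing mxE. Qed.

Lemma pairing_dual_map (f : 'rV[R]_n -> 'rV[R]_n) mu v : linear f ->
  pairing (dual_map f mu) v = pairing mu (f v).
Proof.
move=> hf; rewrite (linear_row_expand v hf) pairingE /pairing mulmx_suml summxE.
by apply: eq_bigr => k _; rewrite mxE -scalemxAl mxE.
Qed.

Lemma pairing_covector (f : 'rV[R]_n -> R) (x v : 'rV[R]_n) : differentiable f x ->
  pairing (covector f x) v = 'D_v f x.
Proof.
move=> df.
rewrite (linear_row_expand v (derive_linear df)) pairingE.
by apply: eq_bigr => k _; rewrite mxE deriveE.
Qed.

Lemma pairingDl (mu nu : 'cV[R]_n) v : pairing (mu + nu) v = pairing mu v + pairing nu v.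
Proof. by rewrite /pairing mulmxDr mxE. Qed.

Lemma pairingZr (mu : 'cV[R]_n) a v : pairing mu (a *: v) = a * pairing mu v.
Proof. by rewrite /pairing -scalemxAl mxE. Qed.

Lemma pairing_delta (mu : 'cV[R]_n) k : pairing mu (delta_mx 0 k) = mu k 0.
Proof.
rewrite pairingE (bigD1 k)//= big1 ?addr0 ?mxE ?eqxx ?mul1r// => j jk.
by rewrite mxE eqxx /= (negbTE jk) mul0r.
Qed.

Lemma pairing_suml (I : finType) (P : pred I) (mu : I -> 'cV[R]_n) v :
  pairing (\sum_(i | P i) mu i) v = \sum_(i | P i) pairing (mu i) v.
Proof. by rewrite /pairing mulmx_sumr summxE. Qed.

Lemma pairingDr (mu : 'cV[R]_n) v w : pairing mu (v + w) = pairing mu v + pairing mu w.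
Proof. by rewrite /pairing mulmxDl mxE. Qed.

Lemma pairing_linear (mu : 'cV[R]_n) : linear (pairing mu : 'rV[R]_n -> R).
Proof. by move=> a u v; rewrite /pairing mulmxDl -scalemxAl !mxE. Qed.

Lemma cvg_pairing (T : Type) (F : set_system T) {FF : Filter F}
    (mu : T -> 'cV[R]_n) (v : T -> 'rV[R]_n) (mu1 : 'cV[R]_n) (v1 : 'rV[R]_n) :
  mu @ F --> mu1 -> v @ F --> v1 ->
  (fun t => pairing (mu t) (v t)) @ F --> pairing mu1 v1.
Proof.
move=> mumu1 vv1; rewrite pairingE.
rewrite (_ : (fun t => _) = (fun t => \sum_k v t 0 k * mu t k 0)); last first.
  by apply/funext => t; rewrite pairingE.
by apply: cvg_bigsum => k _; apply: cvgM; exact: cvg_coord.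
Qed.

End Pairing.

(** * The Lie bracket and the body velocity *)

Section Bracket.
Context {R : realType} {n : nat} {G : lieGroupType R n}.
Local Notation x0 := (chart (1%g : G) 1%g).
Local Notation M := (mulc (1%g : G) (1%g : G)).

Lemma mulc11_dom (x : 'rV[R]_n) : chart_img (1%g : G) x ->
  mulc_dom (1%g : G) (1%g : G) (x, x0).
Proof.
move=> x1; split => /=; [exact: x1|exact: chart_img_center|].
by rewrite chart_cK !mulg1; exact: chart_inv_dom.
Qed.

Lemma differentiable_pairl (V W : normedModType R) (a : V) (y : W) :
  differentiable (fun w : W => (a, w)) y.
Proof. by apply: (@differentiable_pair _ _ _ _ (fun _ => a) id); exact: ex_diff. Qed.

Lemma derive_pairl (V W : normedModType R) (a : V) (y v : W) :
  'D_v (fun w : W => (a, w)) y = (0, v).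
Proof.
rewrite deriveE; last exact: differentiable_pairl.
have dc : differentiable (fun _ : W => a) y by exact: ex_diff.
have di : differentiable (@id W) y by exact: ex_diff.
by rewrite (diff_pair dc di) /= diff_cst (diff_val (f := @id W)).
Qed.

(** Seen as a partial derivative of the product in the charts at 1, the left-invariant field
    inherits its regularity in the base point [x] from the smoothness of multiplication. *)
Lemma left_fieldE (xi x : 'rV[R]_n) : chart_img (1%g : G) x ->
  left_field (G := G) xi x = 'D_(0, xi) M (x, x0).
Proof.
move=> x1; have Mdom := mulc11_dom x1.
have E : chart (1%g : G) \o ltrans (chart_inv (1%g : G) x) \o chart_inv (1%g : G)
    = M \o (fun y => (x, y)).
  by apply/funext => y; rewrite /mulc /ltrans /= mulg1.
rewrite -(derive_pairl x x0 xi).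
rewrite -derive_comp; [|exact: differentiable_pairl|exact: mulc_differentiable].
rewrite deriveE; last first.
  apply: differentiable_comp; [exact: differentiable_pairl|].
  exact: mulc_differentiable.
by rewrite /left_field E /diff.
Qed.

Lemma left_field_differentiable (xi : 'rV[R]_n) :
  differentiable (left_field (G := G) xi) x0.
Proof.
have x01 := chart_img_center (1%g : G).
apply: (@near_eq_differentiable _ _ _ (('D_(0, xi) M) \o (fun x => (x, x0)))).
  by apply: filterS (near_chart_img x01) => x x1; rewrite left_fieldE.
apply: differentiable_comp.
  by apply: (@differentiable_pair _ _ _ _ id (fun _ => x0)); exact: ex_diff.
by apply: mulc_derive_differentiable; exact: mulc11_dom.
Qed.

Lemma left_field_linear (x : 'rV[R]_n) : linear (left_field (G := G) ^~ x).
Proof. by move=> a u v; rewrite /left_field linearP. Qed.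

Lemma lie_bracketE (xi eta : 'rV[R]_n) : lie_bracket (G := G) xi eta =
  'D_xi (left_field (G := G) eta) x0 - 'D_eta (left_field (G := G) xi) x0.
Proof.
rewrite !deriveE; [|exact: left_field_differentiable..].
by rewrite /lie_bracket /diff.
Qed.

Lemma derive_left_field_linear (v : 'rV[R]_n) :
  linear (fun xi => 'D_v (left_field (G := G) xi) x0).
Proof.
move=> a xi eta.
have -> : left_field (G := G) (a *: xi + eta) =
    a \*: left_field (G := G) xi + left_field (G := G) eta.
  by apply/funext => y; exact: left_field_linear.
have D w : derivable (left_field (G := G) w) x0 v.
  by apply: diff_derivable; exact: left_field_differentiable.
by rewrite deriveD ?deriveZ//; exact: derivableZ.
Qed.

Lemma linear_sub (V W : normedModType R) (L1 L2 : V -> W) :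
  linear L1 -> linear L2 -> linear (fun v => L1 v - L2 v).
Proof. by move=> h1 h2 a u v; rewrite h1 h2 scalerBr opprD addrACA. Qed.

Lemma lie_bracket_linearr (xi : 'rV[R]_n) : linear (lie_bracket (G := G) xi).
Proof.
have -> : lie_bracket (G := G) xi = (fun eta =>
    'D_xi (left_field (G := G) eta) x0 - 'D_eta (left_field (G := G) xi) x0).
  by apply/funext => eta; exact: lie_bracketE.
apply: linear_sub; first exact: derive_left_field_linear.
exact/derive_linear/left_field_differentiable.
Qed.

Lemma lie_bracket_linearl (eta : 'rV[R]_n) : linear (lie_bracket (G := G) ^~ eta).
Proof.
have -> : lie_bracket (G := G) ^~ eta = (fun xi =>
    'D_xi (left_field (G := G) eta) x0 - 'D_eta (left_field (G := G) xi) x0).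
  by apply/funext => xi; exact: lie_bracketE.
apply: linear_sub; last exact: derive_left_field_linear.
exact/derive_linear/left_field_differentiable.
Qed.

(** A bilinear map in finite dimension is continuous; the coefficients of the expansion are the
    structure constants. *)
Lemma cvg_lie_bracket (T : Type) (F : set_system T) {FF : Filter F}
    (u h : T -> 'rV[R]_n) (u0 h0 : 'rV[R]_n) : u @ F --> u0 -> h @ F --> h0 ->
  (fun t => lie_bracket (G := G) (u t) (h t)) @ F --> lie_bracket (G := G) u0 h0.
Proof.
move=> uu0 hh0.
have E a b : lie_bracket (G := G) a b =
    \sum_k a 0 k *: \sum_l b 0 l *: lie_bracket (G := G) (delta_mx 0 k) (delta_mx 0 l).
  rewrite (linear_row_expand a (lie_bracket_linearl b)); apply: eq_bigr => k _.
  by rewrite (linear_row_expand b (lie_bracket_linearr _)).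
rewrite E (_ : (fun t => _) = (fun t => \sum_k u t 0 k *: \sum_l h t 0 l *:
    lie_bracket (G := G) (delta_mx 0 k) (delta_mx 0 l))); last first.
  by apply/funext => t; rewrite E.
apply: cvg_bigsum => k _; apply: cvgZ; first exact: cvg_coord.
apply: cvg_bigsum => l _; apply: cvgZ; first exact: cvg_coord.
exact: cvg_cst.
Qed.

End Bracket.

(** * Continuity of the control along a C^1 curve *)

Section Velocity.
Context {R : realType} {n : nat} {G : lieGroupType R n}.
Implicit Types (A : set R) (c : R -> G).

Lemma velocity_comp (W : normedModType R) A c t v (phi : G -> W) : A t ->
  velocity A c t v -> differentiable (phi \o chart_inv (c t)) (chart (c t) (c t)) ->
  deriv_in A (phi \o c) t ('D_v (phi \o chart_inv (c t)) (chart (c t) (c t))).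
Proof.
move=> At [cc dc] dphi.
apply: (near_eq_deriv_in _ At (deriv_in_comp At dc dphi)).
have : \forall s \near within A (nbhs t), chart_dom (c t) (c s).
  exact: (cc _ (near_chart_dom (chart_dom_center (c t)))).
by apply: filterS => s /= ds; rewrite chartK.
Qed.

(** Translating by [(c t)^-1] undoes the tangent map in the kinematic equation. The control thus
    becomes a derivative in a fixed vector space, where uniqueness of derivatives can identify
    it. *)
Lemma body_velocity A c t u : A t ->
  velocity A c t (tangent_map (ltrans (c t)) 1%g u) ->
  deriv_in A (fun s => chart (1%g : G) ((c t)^-1 * c s)%g) t u.
Proof.
move=> At vc.
have dL : mdiff (ltrans (c t)^-1%g \o chart_inv (c t)) (chart (c t) (c t)).
  by apply: mdiff_ltrans_chart_inv; exact: chart_img_center.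
have := velocity_comp (phi := chart (1%g : G) \o ltrans (c t)^-1%g) At vc.
have E : ltrans (c t)^-1%g (c t) = 1%g by rewrite /ltrans mulVg.
have := tangent_map_derive (tangent_map (ltrans (c t)) 1%g u) dL.
rewrite tangent_ltransK E => <-; apply.
rewrite -compA; apply: (mdiff_chart dL).
rewrite /= chart_cK E; exact: chart_dom_center.
Qed.

(** Near [t0] the control is a directional derivative of the product read in the charts at [p^-1]
    and [p], taken at the coordinates of [(c t)^-1] and [c t] in the direction [dc t]. All three
    depend continuously on [t] at [t0]. *)
Lemma control_continuous T c (u : R -> 'rV[R]_n) : 0 < T -> C1_curve T c ->
  (forall t, t \in `[0, T] ->
     velocity `[0, T] c t (tangent_map (ltrans (c t)) 1%g (u t))) ->
  {within `[0, T], continuous u}.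
Proof.
move=> T0 cC1 vc; apply/subspace_continuousP => t0 t0T.
have [cc [dc dcE cdc]] := cC1 _ t0T.
set p := c t0 in cc dcE.
pose a t := chart p^-1%g (c t)^-1%g; pose y t := chart p (c t).
pose N := mulc p^-1%g p.
have cp : \forall t \near within `[0, T] (nbhs t0), chart_dom p (c t).
  exact: (cc _ (near_chart_dom (chart_dom_center p))).
have cV : (fun t => (c t)^-1%g) @ within `[0, T] (nbhs t0) --> p^-1%g.
  exact: cvg_invg cc.
have cpV : \forall t \near within `[0, T] (nbhs t0), chart_dom p^-1%g (c t)^-1%g.
  exact: (cV _ (near_chart_dom (chart_dom_center p^-1%g))).
have Ndom t : chart_dom p (c t) -> chart_dom p^-1%g (c t)^-1%g ->
    mulc_dom p^-1%g p (a t, y t).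
  move=> h1 h2; split => /=; [by exists (c t)^-1%g|by exists (c t)|].
  by rewrite /a /y !chartK// !mulVg; exact: chart_dom_center.
have p0 : chart_dom p (c t0) by exact: chart_dom_center.
have p0V : chart_dom p^-1%g (c t0)^-1%g by exact: chart_dom_center.
have uE : \forall t \near within `[0, T] (nbhs t0), u t = 'D_(0, dc t) N (a t, y t).
  have tT : \forall t \near within `[0, T] (nbhs t0), t \in `[0, T] by exact: withinT.
  near=> t.
  have tT' : t \in `[0, T] by near: t.
  have pt : chart_dom p (c t) by near: t.
  have ptV : chart_dom p^-1%g (c t)^-1%g by near: t.
  have dct : deriv_in `[0, T] (chart p \o c) t (dc t) by near: t.
  (* Both sides are the derivative at [s = t] of [(c t)^-1 * c s] read in the chart at 1. *)
  apply: (deriv_in_segment_unique T0 tT' (body_velocity tT' (vc _ tT'))).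
  have dN : differentiable N (a t, y t) by apply: mulc_differentiable; exact: Ndom.
  have := @deriv_in_comp _ _ _ `[0, T] (chart p \o c)
    (N \o (fun w => (a t, w))) t (dc t) tT' dct.
  rewrite derive_comp; [|exact: differentiable_pairl|exact: dN].
  rewrite derive_pairl => H.
  have {}H := H (differentiable_comp (differentiable_pairl _ _) dN).
  apply: near_eq_deriv_in H => //.
  have [cct _] := vc _ tT'.
  have : \forall s \near within `[0, T] (nbhs t), chart_dom p (c s).
    exact: (cct _ (near_chart_dom pt)).
  by apply: filterS => s /= ds; rewrite /N /mulc /a /= !chartK// mulVg.
have E0 : u t0 = 'D_(0, dc t0) N (a t0, y t0).
  by move: uE; rewrite near_withinE => /nbhs_singleton; exact.
have : (fun t => 'D_(0, dc t) N (a t, y t)) @ within `[0, T] (nbhs t0) --> u t0.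
  rewrite E0; apply: (cvg_derive (iota := fun w => (0, w)) (z := fun t => (a t, y t))).
  - exact: pair0_linear.
  - have Ha : a @ within `[0, T] (nbhs t0) --> a t0.
      apply: (cvg_comp (fun t => (c t)^-1%g) (chart p^-1%g) cV).
      exact: chart_continuous p0V.
    have Hy : y @ within `[0, T] (nbhs t0) --> y t0.
      apply: (cvg_comp c (chart p) cc).
      exact: chart_continuous p0.
    exact: (cvg_pair Ha Hy).
  - exact: cdc.
  - by apply: filterS2 cp cpV => t h1 h2; apply: mulc_differentiable; exact: Ndom.
  - by apply: mulc_differentiable; exact: Ndom.
  - by move=> v; apply: mulc_derive_continuous; exact: Ndom.
apply: cvg_trans; apply: near_eq_cvg.
by apply: filterS uE.
Unshelve. all: by end_near. Qed.

End Velocity.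

(** * Variations of a curve *)

Section Variation.
Context {R : realType} {n : nat} {G : lieGroupType R n}.
Local Notation x0 := (chart (1%g : G) 1%g).
Local Notation M := (mulc (1%g : G) (1%g : G)).
Implicit Types (x w : 'rV[R]_n).

Definition chart_invg x : 'rV[R]_n := chart (1%g : G) (chart_inv (1%g : G) x)^-1%g.

(** The coordinates for which the element and its inverse are both visible in the chart at 1, so
    that body rates can be computed with the single product map [M]. *)
Definition chart1_invertible x : Prop :=
  chart_img (1%g : G) x /\ chart_dom (1%g : G) (chart_inv (1%g : G) x)^-1%g.

Lemma chart1_invertible_center : chart1_invertible x0.
Proof.
split; first exact: chart_img_center.
by rewrite chart_cK invg1; exact: chart_dom_center.
Qed.

Lemma chart_inv_cvg (p : G) x : chart_img p x -> chart_inv p @ x --> chart_inv p x.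
Proof. by case=> q pq <-; exact: chart_inv_continuous. Qed.

Lemma cvg_chart_inv_comp (T : Type) (F : set_system T) {FF : Filter F} (p : G)
    (w : T -> 'rV[R]_n) x : chart_img p x -> w @ F --> x ->
  (fun t => chart_inv p (w t)) @ F --> chart_inv p x.
Proof. by move=> px wx B /(chart_inv_cvg px) /wx. Qed.

Lemma near_chart1_invertible x : chart1_invertible x ->
  \forall y \near x, chart1_invertible y.
Proof.
move=> [x1 xV].
have K : (fun y => (chart_inv (1%g : G) y)^-1%g) @ x --> (chart_inv (1%g : G) x)^-1%g.
  exact: (@cvg_invg R n G _ (nbhs x) _ _ _ (chart_inv_cvg x1)).
have H : \forall y \near x, chart_dom (1%g : G) (chart_inv (1%g : G) y)^-1%g.
  exact: (K _ (near_chart_dom xV)).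
by apply: filterS2 (near_chart_img x1) H => y.
Qed.

Lemma chart_invg_cvg x : chart1_invertible x -> chart_invg @ x --> chart_invg x.
Proof.
move=> [x1 xV].
have K : (fun y => (chart_inv (1%g : G) y)^-1%g) @ x --> (chart_inv (1%g : G) x)^-1%g.
  exact: (@cvg_invg R n G _ (nbhs x) _ _ _ (chart_inv_cvg x1)).
apply: (cvg_comp _ (chart (1%g : G)) K).
exact: chart_continuous xV.
Qed.

Lemma chart_invg_mulc_dom x : chart1_invertible x ->
  mulc_dom (1%g : G) (1%g : G) (chart_invg x, x).
Proof.
move=> [x1 xV]; split => /=; [by exists (chart_inv (1%g : G) x)^-1%g|exact: x1|].
by rewrite /chart_invg chartK// mulVg mulg1; exact: chart_dom_center.
Qed.

(* The derivative at [y = x], in the direction [w], of the group element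
   [(chart_inv 1 x)^-1 * chart_inv 1 y] read in the chart at 1. *)
Definition body_rate x w : 'rV[R]_n := 'D_(0, w) M (chart_invg x, x).

Lemma body_rateE x w : chart1_invertible x ->
  body_rate x w = 'D_w (M \o (fun y => (chart_invg x, y))) x.
Proof.
move=> xg; have dM := mulc_differentiable (chart_invg_mulc_dom xg).
by rewrite (derive_comp w (differentiable_pairl _ x) dM) derive_pairl.
Qed.

(** This is where the chart is as good as the logarithm: at [eps = 0] the left translate of the
    variation of the curve is exactly the test curve. *)
Lemma body_rate_center w : body_rate x0 w = w.
Proof.
rewrite body_rateE; last exact: chart1_invertible_center.
rewrite -[RHS](derive_chart_chart_inv w (chart_img_center (1%g : G))).
congr ('D_w _ x0); apply/funext => y.
rewrite /mulc /chart_invg /= chart_cK invg1 chartK ?mul1g ?mulg1//.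
exact: chart_dom_center.
Qed.

Lemma cvg_body_rate (T : Type) (F : set_system T) {FF : Filter F}
    (x w : T -> 'rV[R]_n) (x1 w1 : 'rV[R]_n) : chart1_invertible x1 ->
  x @ F --> x1 -> w @ F --> w1 ->
  (fun t => body_rate (x t) (w t)) @ F --> body_rate x1 w1.
Proof.
move=> gx1 xx1 ww1.
have H : \forall t \near F, chart1_invertible (x t).
  exact: (xx1 _ (near_chart1_invertible gx1)).
apply: (cvg_derive (iota := fun w => (0, w)) (z := fun t => (chart_invg (x t), x t))).
- exact: pair0_linear.
- have Hi : (fun t => chart_invg (x t)) @ F --> chart_invg x1.
    exact: (cvg_comp x chart_invg xx1 (chart_invg_cvg gx1)).
  exact: (cvg_pair Hi xx1).
- exact: ww1.
- by apply: filterS H => t gt; apply: mulc_differentiable; exact: chart_invg_mulc_dom.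
- by apply: mulc_differentiable; exact: chart_invg_mulc_dom.
- by move=> v; apply: mulc_derive_continuous; exact: chart_invg_mulc_dom.
Qed.

(** The chart at 1 need not send the identity to the origin, hence the base point [x0]. *)
Definition chart_line w (s : R) : 'rV[R]_n := x0 + s *: w.

Lemma is_derive_line (W : normedModType R) (c w : W) (s : R) :
  is_derive s (1 : R) (fun s => c + s *: w) w.
Proof.
have d : differentiable ( *:%R ^~ w : R -> W) s by exact: ex_diff.
have D : derivable ( *:%R ^~ w : R -> W) s 1 by exact: diff_derivable.
have DE : 'D_1 ( *:%R ^~ w : R -> W) s = w by rewrite deriveE// diff_val scale1r.
have E : (fun s => c + s *: w) = cst c + ( *:%R ^~ w : R -> W) by [].
rewrite E; apply: DeriveDef.
  by apply: derivableD; [exact: derivable_cst|exact: D].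
by rewrite (deriveD (derivable_cst _ _ _) D) DE derive_cst add0r.
Qed.

Lemma is_derive_chart_line w (s : R) : is_derive s (1 : R) (chart_line w) w.
Proof. exact: is_derive_line. Qed.

Lemma chart_line_differentiable w (s : R) : differentiable (chart_line w) s.
Proof. by apply/derivable1_diffP; have [] := is_derive_chart_line w s. Qed.

Lemma derive_chart_line w (s : R) : 'D_1 (chart_line w) s = w.
Proof. by have [] := is_derive_chart_line w s. Qed.

Lemma chart_line0 w : chart_line w 0 = x0.
Proof. by rewrite /chart_line scale0r addr0. Qed.

Lemma cvg_chart_line (h : R -> 'rV[R]_n) (z : R * R) : continuous h ->
  (fun y : R * R => chart_line (h y.2) y.1) @ z --> chart_line (h z.2) z.1.
Proof.
move=> ch; apply: cvgD; first exact: cvg_cst.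
apply: cvgZ; first exact: cvg_fst.
exact: (cvg_comp snd h cvg_snd (ch z.2)).
Qed.

(* The curve [eps |-> gm * exp(eps w)], with the exponential map replaced by
   the inverse chart at the identity. *)
Definition perturb (gm : G) w (s : R) : G := (gm * chart_inv (1%g : G) (chart_line w s))%g.

Lemma perturb0 gm w : perturb gm w 0 = gm.
Proof. by rewrite /perturb chart_line0 chart_cK mulg1. Qed.

Lemma mdiff_perturb gm w s : chart_img (1%g : G) (chart_line w s) ->
  mdiff (perturb gm w) s.
Proof.
move=> gx; apply: (@mdiff_comp _ _ _ _ _ (chart_line w) (ltrans gm \o chart_inv (1%g : G))).
  exact: chart_line_differentiable.
exact: mdiff_ltrans_chart_inv.
Qed.

(** The factor [gm] cancels in [(gm * k)^-1 * (gm * k')], so the translated velocity depends only on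
    the line in the chart at 1. *)
Lemma tangent_perturb gm w s : chart1_invertible (chart_line w s) ->
  tangent_map (ltrans (perturb gm w s)^-1%g) (perturb gm w s)
    ('D_1 (chart (perturb gm w s) \o perturb gm w) s) = body_rate (chart_line w s) w.
Proof.
move=> gx; have [x1 xV] := gx.
rewrite (tangent_ltrans _ _ (mdiff_perturb gm x1)) mulVg body_rateE//.
set K := M \o _.
have dK : differentiable K (chart_line w s).
  apply: differentiable_comp; first exact: differentiable_pairl.
  by apply: mulc_differentiable; exact: chart_invg_mulc_dom.
have := derive_comp (1 : R) (chart_line_differentiable w s) dK.
rewrite derive_chart_line => <-.
congr ('D_1 _ s); apply/funext => y.
rewrite /K /mulc /chart_invg /= chartK// mulg1 /ltrans /perturb.
by rewrite invgM -!mulgA mulKg.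
Qed.

Lemma velocity_mdiff (f : R -> G) s : mdiff f s ->
  velocity setT f s ('D_1 (chart (f s) \o f) s).
Proof.
move=> [cf df]; split; first exact: cvg_within_filter.
by apply/is_deriveP; apply: DeriveDef => //; apply/derivable1_diffP.
Qed.

(** The formula for the induced variation constrains the control at [eps = 0] only, so the control
    may move affinely in [eps], with the prescribed variation as slope. *)
Lemma agent_variation_perturb (T a : R) (g gm : R -> G) (u up : R -> 'rV[R]_n)
    (h dh : R -> 'rV[R]_n) :
  0 < a -> 0 <= T ->
  continuous gm -> (forall t, t \in `[0, T] -> gm t = g t) ->
  continuous up -> (forall t, t \in `[0, T] -> up t = u t) ->
  continuous h -> continuous dh ->
  (forall t, t \in `[0, T] -> deriv_in `[0, T] h t (dh t)) ->
  h 0 = 0 -> h T = 0 ->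
  (forall x : R * R, strip a T x -> chart1_invertible (chart_line (h x.2) x.1)) ->
  exists dgam eta dom deta,
  agent_variation a T g u (fun eps t => perturb (gm t) (h t) eps)
    (fun eps t => up t + eps *: (dh t + lie_bracket (G := G) (up t) (h t)))
    dgam eta dom deta.
Proof.
move=> a0 T0 cgm gmE cup upE ch cdh dhE h0 hT hgood.
exists (fun eps t => 'D_1 (chart (perturb (gm t) (h t) eps) \o perturb (gm t) (h t)) eps).
exists (fun eps t => body_rate (chart_line (h t) eps) (h t)).
exists (fun=> fun t => dh t + lie_bracket (G := G) (up t) (h t)).
exists dh.
have hgood' eps t : strip a T (eps, t) -> chart1_invertible (chart_line (h t) eps).
  exact: (hgood (eps, t)).
have st0 t : t \in `[0, T] -> strip a T (0, t) by move=> tT; split; rewrite ?normr0.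
have cdom : continuous (fun t => dh t + lie_bracket (G := G) (up t) (h t)).
  by move=> t; apply: cvgD; [exact: cdh|apply: cvg_lie_bracket; [exact: cup|exact: ch]].
have snd_cont (W : topologicalType) (f : R -> W) (z : R * R) : continuous f ->
    (fun y : R * R => f y.2) @ z --> f z.2.
  by move=> cf; exact: (cvg_comp snd f cvg_snd (cf z.2)).
split.
- by move=> t tT; rewrite perturb0 gmE.
- by move=> t tT; rewrite scale0r addr0 upE.
- apply/subspace_continuousP => z zs; apply: cvg_within_filter.
  have K : (fun y : R * R => chart_inv (1%g : G) (chart_line (h y.2) y.1)) @ z -->
      chart_inv (1%g : G) (chart_line (h z.2) z.1).
    have [zi _] := hgood _ zs.
    exact: (@cvg_chart_inv_comp _ (nbhs z) _ _ _ _ zi (cvg_chart_line ch)).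
  exact: (@cvg_mulg R n G _ (nbhs z) _ _ _ _ _ (snd_cont _ gm z cgm) K).
- apply/subspace_continuousP => z zs; apply: cvg_within_filter.
  apply: cvgD; first exact: (snd_cont _ up).
  by apply: cvgZ; [exact: cvg_fst|exact: (snd_cont _ _ _ cdom)].
- by move=> eps t st; apply: velocity_mdiff; apply: mdiff_perturb; have [] := hgood' _ _ st.
- by move=> eps t st; rewrite tangent_perturb//; exact: hgood'.
- apply/subspace_continuousP => z zs; apply: cvg_within_filter.
  apply: cvg_body_rate; first exact: hgood.
    exact: cvg_chart_line.
  exact: (snd_cont _ h).
- by move=> eps t st; exact: is_derive_line.
- apply/subspace_continuousP => z zs; apply: cvg_within_filter.
  exact: (snd_cont _ _ _ cdom).
(* Where the test curve vanishes, the perturbed curve does not depend on [eps]. *)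
- have E (k : G) (q : G) : 'D_1 (chart q \o perturb k 0) 0 = 0.
    rewrite (_ : _ \o _ = cst (chart q k)) ?derive_cst//.
    by apply/funext => s; rewrite /perturb /chart_line /= scaler0 addr0 chart_cK mulg1.
  by split; rewrite ?h0 ?hT E.
- move=> t tT; apply: eq_deriv_in (dhE _ tT) => // s sT.
  by rewrite chart_line0 body_rate_center.
- exact: continuous_subspaceT.
- by move=> t tT; rewrite chart_line0 body_rate_center upE.
Qed.

Lemma chart1_invertible_small (phi : R -> R) (v : 'rV[R]_n) (H : R) :
  (forall t, `|phi t| <= H) ->
  exists2 a : R, 0 < a & forall x : R * R, `|x.1| < a ->
    chart1_invertible (chart_line (phi x.2 *: v) x.1).
Proof.
move=> phiH.
have [d /= d0 Hd] := (nbhs_ballP _ _).1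
  (near_chart1_invertible (chart1_invertible_center)).
have H0 : 0 <= H by rewrite (le_trans _ (phiH 0)).
(* The summand 1 keeps the divisor positive even when [H] or [v] is zero. *)
pose b := H * `|v| + 1.
have b0 : 0 < b by rewrite ltr_wpDl// mulr_ge0.
exists (d / b); first exact: divr_gt0.
move=> x xa; apply: Hd; rewrite -ball_normE /= /chart_line opprD addNKr normrN.
rewrite !normrZ (@le_lt_trans _ _ (`|x.1| * b))//; last by rewrite -ltr_pdivlMr.
rewrite ler_wpM2l// (@le_trans _ _ (H * `|v|))//; last by rewrite lerDl.
by rewrite ler_wpM2r.
Qed.

End Variation.

(** * Potentials and forces *)

Section Potential.
Context {R : realType} {n : nat} {G : lieGroupType R n}.
Local Notation x0 := (chart (1%g : G) 1%g).

Implicit Types (V : G -> G -> R) (p q : G) (y v w : 'rV[R]_n).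

Definition pair_in_charts (V : G -> G -> R) (p q : G) (x : 'rV[R]_n * 'rV[R]_n) : R :=
  V (chart_inv p x.1) (chart_inv q x.2).

Lemma pair_in_charts_differentiable V p q x : C1_pair V ->
  chart_img p x.1 -> chart_img q x.2 -> differentiable (pair_in_charts V p q) x.
Proof. by move=> hV px qx; have [+ _] := hV p q; apply. Qed.

Lemma pair_in_charts_derive_continuous V p q x (v : 'rV[R]_n * 'rV[R]_n) : C1_pair V ->
  chart_img p x.1 -> chart_img q x.2 ->
  {for x, continuous ('D_v (pair_in_charts V p q))}.
Proof. by move=> hV px qx; have [_ /(_ v)] := hV p q; apply. Qed.

Lemma cvg_chart (T : Type) (F : set_system T) (q : T -> G) p q1 :
  chart_dom p q1 -> q @ F --> q1 -> (fun t => chart p (q t)) @ F --> chart p q1.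
Proof. by move=> pq qq1 B /(chart_continuous _ _ pq) /qq1. Qed.

Lemma near_chart_dom_cvg (T : Type) (F : set_system T) (q : T -> G) q1 :
  q @ F --> q1 -> \forall t \near F, chart_dom q1 (q t).
Proof. by move=> qq1; exact: (qq1 _ (near_chart_dom (chart_dom_center q1))). Qed.

Lemma cvg_potential (T : Type) (F : set_system T) {FF : Filter F} V
    (q k : T -> G) q1 k1 : C1_pair V -> q @ F --> q1 -> k @ F --> k1 ->
  (fun t => V (q t) (k t)) @ F --> V q1 k1.
Proof.
move=> hV qq1 kk1.
have /differentiable_continuous : differentiable (pair_in_charts V q1 k1)
    (chart q1 q1, chart k1 k1).
  by apply: pair_in_charts_differentiable => //; exact: chart_img_center.
have Hq := cvg_chart (chart_dom_center q1) qq1.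
have Hk := cvg_chart (chart_dom_center k1) kk1.
move=> /(cvg_comp _ _ (cvg_pair Hq Hk)).
rewrite {2}/pair_in_charts /= !chart_cK; apply: cvg_trans.
apply: near_eq_cvg.
apply: filterS2 (near_chart_dom_cvg qq1) (near_chart_dom_cvg kk1) => t qt kt.
by rewrite /pair_in_charts /= !chartK.
Qed.

Lemma potential_slice V q p q1 : chart_dom q q1 ->
  V q1 \o chart_inv p = pair_in_charts V q p \o (fun y => (chart q q1, y)).
Proof. by move=> qq1; apply/funext => y; rewrite /pair_in_charts /= chartK. Qed.

Lemma potential_slice_differentiable V q p y : C1_pair V -> chart_img p y ->
  differentiable (V q \o chart_inv p) y.
Proof.
move=> hV py; rewrite (potential_slice _ _ (chart_dom_center q)).
apply: differentiable_comp; first exact: differentiable_pairl.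
by apply: pair_in_charts_differentiable => //; exact: chart_img_center.
Qed.

(** Reading the moving point [q t] in the chart at its limit turns derivatives of varying functions
    into partial derivatives of one fixed C^1 function of two coordinates. *)
Lemma cvg_potential_derive (T : Type) (F : set_system T) {FF : Filter F} V (p : G)
    (q : T -> G) (y w : T -> 'rV[R]_n) q1 y1 w1 :
  C1_pair V -> chart_img p y1 ->
  q @ F --> q1 -> y @ F --> y1 -> w @ F --> w1 ->
  (fun t => 'D_(w t) (V (q t) \o chart_inv p) (y t)) @ F -->
    'D_w1 (V q1 \o chart_inv p) y1.
Proof.
move=> hV py1 qq1 yy1 ww1.
have E q2 y2 w2 : chart_dom q1 q2 -> chart_img p y2 ->
    'D_w2 (V q2 \o chart_inv p) y2 =
    'D_(0, w2) (pair_in_charts V q1 p) (chart q1 q2, y2).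
  move=> d2 py2; rewrite (potential_slice _ _ d2).
  have dP : differentiable (pair_in_charts V q1 p) (chart q1 q2, y2).
    by apply: pair_in_charts_differentiable => //; exists q2.
  by rewrite (derive_comp w2 (differentiable_pairl _ y2) dP) derive_pairl.
have Hy : \forall t \near F, chart_img p (y t) by exact: (yy1 _ (near_chart_img py1)).
have Hq := near_chart_dom_cvg qq1.
have q11 := chart_dom_center q1.
rewrite E//.
have : (fun t => 'D_(0, w t) (pair_in_charts V q1 p) (chart q1 (q t), y t)) @ F -->
    'D_(0, w1) (pair_in_charts V q1 p) (chart q1 q1, y1).
  apply: (cvg_derive (iota := fun w => (0, w)) (z := fun t => (chart q1 (q t), y t))).
  - exact: pair0_linear.
  - exact: (cvg_pair (cvg_chart q11 qq1) yy1).
  - exact: ww1.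
  - apply: filterS2 Hy Hq => t py qt.
    by apply: pair_in_charts_differentiable => //; exists (q t).
  - by apply: pair_in_charts_differentiable => //; exists q1.
  - by move=> v; apply: pair_in_charts_derive_continuous => //; exists q1.
apply: cvg_trans; apply: near_eq_cvg.
by apply: filterS2 Hy Hq => t py qt; rewrite E.
Qed.

Lemma tangent_map_linear (phi : G -> G) (p : G) : linear (tangent_map phi p).
Proof. by move=> a u v; rewrite /tangent_map linearP. Qed.

(** The chain rule in dual form. It brings a force to the shape in which the first variation
    produces it, a derivative at the identity. *)
Lemma pairing_cotangent_differential (phi : G -> R) (g : G) v :
  differentiable (phi \o chart_inv g) (chart g g) ->
  pairing (cotangent_map (ltrans g) 1%g (differential phi g)) v =
  'D_v (phi \o ltrans g \o chart_inv (1%g : G)) x0.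
Proof.
move=> dphi; rewrite /cotangent_map pairing_dual_map; last exact: tangent_map_linear.
rewrite /differential pairing_covector//.
have g1 : ltrans g 1%g = g by rewrite /ltrans mulg1.
have d1 : mdiff (ltrans g \o chart_inv (1%g : G)) x0.
  by apply: mdiff_ltrans_chart_inv; exact: chart_img_center.
rewrite tangent_map_derive// g1.
have dL : differentiable (chart g \o ltrans g \o chart_inv (1%g : G)) x0.
  rewrite -compA; apply: (mdiff_chart d1).
  by rewrite /= chart_cK g1; exact: chart_dom_center.
have Ex : (chart g \o ltrans g \o chart_inv (1%g : G)) x0 = chart g g.
  by rewrite /= chart_cK g1.
rewrite -Ex in dphi *.
rewrite -(derive_comp v dL dphi); apply: near_eq_derive.
have : \forall y \near x0, chart_dom g ((ltrans g \o chart_inv (1%g : G)) y).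
  have [c1 _] := d1; apply: (c1 _ (near_chart_dom _)).
  by rewrite /= chart_cK g1; exact: chart_dom_center.
by apply: filterS => y gy; rewrite /= chartK.
Qed.

End Potential.

(** * First variation of the action *)

(** An edge at [i0] is counted once from each of its ends, and symmetry of [v] merges the two
    halves. A loop at [i0] would be counted only once; irreflexivity excludes it. *)
Lemma symmetric_half_sum (R : numFieldType) (I : finType) (E : rel I) (v : I -> I -> R)
    (i0 : I) : symmetric E -> irreflexive E ->
  (forall i j, E i j -> v i j = v j i) ->
  \sum_i 2^-1 * (\sum_(j | E i j) v i j) =
  \sum_(j | E i0 j) v i0 j
  + \sum_(i | i != i0) 2^-1 * (\sum_(j | E i j && (j != i0)) v i j).
Proof.
move=> Esym Eirr vsym.
have row i : \sum_(j | E i j) v i j =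
    (if E i i0 then v i i0 else 0) + \sum_(j | E i j && (j != i0)) v i j.
  rewrite big_mkcond (bigD1 i0)//=; congr (_ + _).
  by rewrite -big_mkcondl.
have col : \sum_(i | i != i0) (if E i i0 then v i i0 else 0) = \sum_(j | E i0 j) v i0 j.
  rewrite -big_mkcondr; apply: eq_big => [i|i].
    by rewrite Esym; case: eqVneq => [->|]//; rewrite Eirr.
  by move=> /andP[_ Ei]; exact: vsym.
have rest : \sum_(i | i != i0) 2^-1 * (\sum_(j | E i j) v i j) =
    2^-1 * (\sum_(j | E i0 j) v i0 j)
    + \sum_(i | i != i0) 2^-1 * (\sum_(j | E i j && (j != i0)) v i j).
  by rewrite -col mulr_sumr -big_split /=; apply: eq_bigr => i _; rewrite row mulrDr.
rewrite (bigD1 i0)//= rest addrA; congr (_ + _).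
by field.
Qed.

Section Lagrangian.
Context {R : realType} {n r : nat} {G : lieGroupType R n}.
Implicit Types (C : 'I_r -> G -> 'rV[R]_n -> R) (V : 'I_r -> 'I_r -> G -> G -> R).

Lemma translated_multiplier_pairing (g : 'I_r -> G) (l : 'I_r -> 'cV[R]_n) i u :
  pairing (translated_multiplier g l i) (tangent_map (ltrans (g i)) 1%g u)
  = pairing (l i) u.
Proof.
rewrite /translated_multiplier /cotangent_map pairing_dual_map.
  by rewrite tangent_ltransK.
exact: tangent_map_linear.
Qed.

Lemma lagrangianE (E : rel 'I_r) C V g u l :
  lagrangian E C V g u (translated_multiplier g l) =
  \sum_i (C i (g i) (u i) + pairing (l i) (u i))
  + \sum_i 2^-1 * (\sum_(j | E i j) V i j (g i) (g j)).
Proof.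
rewrite /lagrangian /total_cost !big_split /= addrA; congr (_ + _ + _).
by apply: eq_bigr => i _; rewrite translated_multiplier_pairing.
Qed.

End Lagrangian.

Section IsDerive.
Context {R : realType}.

Lemma is_derive_comp_line (V W : normedModType R) (f : V -> W) (c w : V) (s : R) :
  differentiable f (c + s *: w) ->
  is_derive s (1 : R) (fun s => f (c + s *: w)) ('D_w f (c + s *: w)).
Proof.
move=> df; have [dl lE] := is_derive_line c w s.
have dl' : differentiable (fun s : R => c + s *: w) s by apply/derivable1_diffP.
have := derive_comp (1 : R) dl' df; rewrite lE => E.
apply: DeriveDef; last exact: E.
by apply/derivable1_diffP; exact: (differentiable_comp dl' df).
Qed.

Lemma is_derive_bigsum (W : normedModType R) (I : finType) (P : pred I)
    (f : I -> R -> W) (df : I -> W) (s : R) :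
  (forall i, P i -> is_derive s (1 : R) (f i) (df i)) ->
  is_derive s (1 : R) (fun s => \sum_(i | P i) f i s) (\sum_(i | P i) df i).
Proof.
move=> H; rewrite (_ : (fun s => _) = \sum_(i | P i) f i); last first.
  by apply/funext => x; rewrite fct_sumE.
elim/big_ind2 : _ => //; first exact: is_derive_cst.
by move=> *; exact: is_deriveD.
Qed.

Lemma is_derive_add3 (W : normedModType R) (a : W) (f1 f2 f3 : R -> W)
    (d1 d2 d3 : W) (s : R) :
  is_derive s (1 : R) f1 d1 -> is_derive s (1 : R) f2 d2 ->
  is_derive s (1 : R) f3 d3 ->
  is_derive s (1 : R) (fun s => a + (f1 s + f2 s) + f3 s) (d1 + d2 + d3).
Proof.
move=> h1 h2 h3.
have h12 := is_deriveD h1 h2.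
have ha := is_deriveD (is_derive_cst a s (1 : R)) h12.
have := is_deriveD ha h3; rewrite add0r; exact.
Qed.
End IsDerive.

Section FirstVariation.
Context {R : realType} {n r : nat} {G : lieGroupType R n}.
Local Notation x0 := (chart (1%g : G) 1%g).
Local Notation mu := (@lebesgue_measure R).
Context {E : rel 'I_r} {C : 'I_r -> G -> 'rV[R]_n -> R} {V : 'I_r -> 'I_r -> G -> G -> R}.
Hypothesis Esym : symmetric E.
Hypothesis Eirr : irreflexive E.
Hypothesis Creg : forall i g, Ck 1 (C i g) setT.
Hypothesis Cinv : forall i (h g : G) u, C i (ltrans h g) u = C i g u.
Hypothesis Vsym : forall i j, E i j -> forall g h, V i j g h = V j i h g.
Hypothesis Vinv : forall i j, E i j ->
  forall h g1 g2, V i j (ltrans h g1) (ltrans h g2) = V i j g1 g2.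
Hypothesis Vreg : forall i j, E i j -> C1_pair (V i j).

(** The costs are regular in the control at each fixed group element. Moving that element to 1 is
    what makes the cost and its derivative continuous along a curve on which the group element
    varies too. *)
Lemma cost_reduced i g u : C i g u = C i 1%g u.
Proof. by rewrite -(Cinv i g^-1%g g u) /ltrans mulVg. Qed.

Lemma cost_differentiable i u : differentiable (C i 1%g) u.
Proof. by have [+ _] := Creg i 1%g; apply. Qed.

Lemma cost_derive_continuous i u v : {for u, continuous ('D_v (C i 1%g))}.
Proof. by have [_ /(_ v)] := Creg i 1%g; apply. Qed.

Lemma cost_covector i g u v : pairing (partial_u C i g u) v = 'D_v (C i 1%g) u.
Proof.
rewrite /partial_u (_ : C i g = C i 1%g); last first.
  by apply/funext => w; exact: cost_reduced.
by rewrite pairing_covector//; exact: cost_differentiable.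
Qed.

Lemma cvg_cost_derive (T : Type) (F : set_system T) {FF : Filter F} i
    (u w : T -> 'rV[R]_n) (u1 w1 : 'rV[R]_n) : u @ F --> u1 -> w @ F --> w1 ->
  (fun t => 'D_(w t) (C i 1%g) (u t)) @ F --> 'D_w1 (C i 1%g) u1.
Proof.
move=> uu1 ww1; apply: (cvg_derive (iota := id)) => //.
- by near=> t; exact: cost_differentiable.
- exact: cost_differentiable.
- by move=> v; exact: cost_derive_continuous.
Unshelve. all: by end_near. Qed.

Lemma cvg_cost (T : Type) (F : set_system T) {FF : Filter F} i
    (u : T -> 'rV[R]_n) (u1 : 'rV[R]_n) : u @ F --> u1 ->
  (fun t => C i 1%g (u t)) @ F --> C i 1%g u1.
Proof.
by move=> uu1 B /(differentiable_continuous (cost_differentiable i u1)) /uu1.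
Qed.

(* Symmetry and left invariance move the varying factor [k] alone into the
   second slot, where the other argument no longer depends on it. *)
Lemma potential_perturb i j (gi gj k : G) : E i j ->
  V i j (gi * k)%g gj = V j i (gi^-1 * gj)%g k.
Proof.
move=> Eij; rewrite -(Vsym Eij) -(Vinv Eij gi k (gi^-1 * gj)%g) /ltrans.
by rewrite mulVKg.
Qed.

Definition force (i j : 'I_r) (gi gj : G) : 'cV[R]_n :=
  cotangent_map (ltrans gi) 1%g
    (differential (fun h => reduced_potential V i j (ltrans h^-1%g gj)) gi).

(** By invariance and symmetry the reduced potential at [h^-1 * gj] is [V j i gj h], a function of
    [h] in the second slot; translating by [gi] then leaves a derivative at the identity. *)
Lemma pairing_force i j gi gj v : E i j ->
  pairing (force i j gi gj) v =
  'D_v (V j i (gi^-1 * gj)%g \o chart_inv (1%g : G)) x0.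
Proof.
move=> Eij; rewrite /force.
have Eji : E j i by rewrite Esym.
have -> : (fun h => reduced_potential V i j (ltrans h^-1%g gj)) = V j i gj.
  apply/funext => h; rewrite /reduced_potential /ltrans -(Vsym Eij).
  by rewrite -(Vinv Eij h) /ltrans mulg1 mulVKg.
rewrite pairing_cotangent_differential; last first.
  by apply: potential_slice_differentiable; [exact: Vreg|exact: chart_img_center].
congr ('D_v _ x0); apply/funext => y.
by rewrite /= -(Vsym Eij) -potential_perturb.
Qed.

Section Curves.
Variables (i0 : 'I_r) (gm : 'I_r -> R -> G) (up : 'I_r -> R -> 'rV[R]_n).
Variables (lc : 'I_r -> R -> 'cV[R]_n) (h dh : R -> 'rV[R]_n).
Hypothesis cgm : forall i, continuous (gm i).
Hypothesis cup : forall i, continuous (up i).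
Hypothesis clc : forall i, continuous (lc i).
Hypothesis ch : continuous h.
Hypothesis cdh : continuous dh.

Definition single (f : R -> 'rV[R]_n) (i : 'I_r) (t : R) : 'rV[R]_n :=
  if i == i0 then f t else 0.

Definition varied_g (eps : R) (i : 'I_r) (t : R) : G :=
  perturb (gm i t) (single h i t) eps.

Definition varied_u (eps : R) (i : 'I_r) (t : R) : 'rV[R]_n :=
  up i t + eps *: (single dh i t + lie_bracket (G := G) (up i t) (single h i t)).

Definition du0 (t : R) : 'rV[R]_n := dh t + lie_bracket (G := G) (up i0 t) (h t).

(** What does not involve agent [i0]: the costs and multiplier terms of the others and the edges
    that avoid [i0]. It is constant in [eps]. *)
Definition rest_lagrangian (t : R) : R :=
  \sum_(i | i != i0) (C i 1%g (up i t) + pairing (lc i t) (up i t))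
  + \sum_(i | i != i0) 2^-1 * (\sum_(j | E i j && (j != i0)) V i j (gm i t) (gm j t)).

Definition varied_lagrangian (eps t : R) : R :=
  rest_lagrangian t
  + (C i0 1%g (up i0 t + eps *: du0 t) + pairing (lc i0 t) (up i0 t + eps *: du0 t))
  + \sum_(j | E i0 j) V j i0 ((gm i0 t)^-1 * gm j t)%g
       (chart_inv (1%g : G) (chart_line (G := G) (h t) eps)).

Definition varied_lagrangian_derive (eps t : R) : R :=
  'D_(du0 t) (C i0 1%g) (up i0 t + eps *: du0 t) + pairing (lc i0 t) (du0 t)
  + \sum_(j | E i0 j) 'D_(h t) (V j i0 ((gm i0 t)^-1 * gm j t)%g
       \o chart_inv (1%g : G)) (chart_line (G := G) (h t) eps).

Lemma varied_lagrangianE eps t :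
  lagrangian E C V (varied_g eps ^~ t) (varied_u eps ^~ t)
    (translated_multiplier (varied_g eps ^~ t) (lc ^~ t)) = varied_lagrangian eps t.
Proof.
have g_other j : j != i0 -> varied_g eps j t = gm j t.
  move=> /negbTE jn; rewrite /varied_g /single jn /perturb /chart_line.
  by rewrite scaler0 addr0 chart_cK mulg1.
have u_other j : j != i0 -> varied_u eps j t = up j t.
  move=> /negbTE jn; rewrite /varied_u /single jn add0r.
  have -> : lie_bracket (G := G) (up j t) 0 = 0.
    exact: (linear_row0 (lie_bracket_linearr (G := G) (up j t))).
  by rewrite scaler0 addr0.
rewrite lagrangianE (symmetric_half_sum i0 Esym Eirr) => [|i j Eij]; last exact: Vsym.
rewrite (bigD1 i0)//= /varied_lagrangian /rest_lagrangian.
rewrite cost_reduced.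
have -> : varied_u eps i0 t = up i0 t + eps *: du0 t.
  by rewrite /varied_u /single eqxx.
have -> : \sum_(i | i != i0) (C i (varied_g eps i t) (varied_u eps i t) +
     pairing (lc i t) (varied_u eps i t)) =
   \sum_(i | i != i0) (C i 1%g (up i t) + pairing (lc i t) (up i t)).
  by apply: eq_bigr => i ii0; rewrite cost_reduced u_other.
have -> : \sum_(j | E i0 j) V i0 j (varied_g eps i0 t) (varied_g eps j t) =
   \sum_(j | E i0 j) V j i0 ((gm i0 t)^-1 * gm j t)%g
       (chart_inv (1%g : G) (chart_line (G := G) (h t) eps)).
  apply: eq_bigr => j Ej; rewrite (g_other j); last first.
    by apply/eqP => ji; move: Ej; rewrite ji Eirr.
  by rewrite -potential_perturb// /varied_g /single eqxx.
have -> : \sum_(i | i != i0) 2^-1 * (\sum_(j | E i j && (j != i0))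
     V i j (varied_g eps i t) (varied_g eps j t)) =
   \sum_(i | i != i0) 2^-1 * (\sum_(j | E i j && (j != i0)) V i j (gm i t) (gm j t)).
  apply: eq_bigr => i ii0; congr (_ * _); apply: eq_bigr => j /andP[_ ji0].
  by rewrite !g_other.
rewrite [in RHS]addrAC -!addrA; ring.
Qed.

Lemma varied_lagrangian_is_derive eps t :
  chart_img (1%g : G) (chart_line (G := G) (h t) eps) ->
  is_derive eps (1 : R) (varied_lagrangian ^~ t) (varied_lagrangian_derive eps t).
Proof.
move=> himg.
have dC := is_derive_comp_line (cost_differentiable i0 (up i0 t + eps *: du0 t)).
have dP : is_derive eps (1 : R) (fun s => pairing (lc i0 t) (up i0 t + s *: du0 t))
    (pairing (lc i0 t) (du0 t)).
  rewrite (_ : (fun s => _) = (fun s : R => pairing (lc i0 t) (up i0 t)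
      + s *: (pairing (lc i0 t) (du0 t) : R))); first exact: is_derive_line.
  by apply/funext => s; rewrite addrC pairing_linear addrC.
have dV j : E i0 j -> is_derive eps (1 : R) (fun s => V j i0 ((gm i0 t)^-1 * gm j t)%g
       (chart_inv (1%g : G) (chart_line (G := G) (h t) s)))
    ('D_(h t) (V j i0 ((gm i0 t)^-1 * gm j t)%g
       \o chart_inv (1%g : G)) (chart_line (G := G) (h t) eps)).
  move=> Ej; apply: (@is_derive_comp_line _ _ _ (V j i0 ((gm i0 t)^-1 * gm j t)%g
       \o chart_inv (1%g : G))).
  by apply: potential_slice_differentiable; [apply: Vreg; rewrite Esym|].
exact: (is_derive_add3 (rest_lagrangian t) dC dP (is_derive_bigsum dV)).
Qed.

Lemma du0_continuous : continuous du0.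
Proof.
move=> t; apply: cvgD; first exact: cdh.
by apply: cvg_lie_bracket; [exact: cup|exact: ch].
Qed.

Lemma rel_continuous j : continuous (fun t => (gm i0 t)^-1 * gm j t)%g.
Proof.
move=> t; apply: (@cvg_mulg R n G _ (nbhs t)); last exact: cgm.
exact: (@cvg_invg R n G _ (nbhs t) _ _ _ (@cgm i0 t)).
Qed.

Lemma rest_lagrangian_continuous : continuous rest_lagrangian.
Proof.
move=> t; apply: cvgD.
  apply: cvg_bigsum => i _; apply: cvgD; first by apply: cvg_cost; exact: cup.
  by apply: cvg_pairing; [exact: clc|exact: cup].
apply: cvg_bigsum => i _; apply: cvgM; first exact: cvg_cst.
apply: cvg_bigsum => j /andP[Eij _].
by apply: cvg_potential; [exact: Vreg|exact: cgm|exact: cgm].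
Qed.

Lemma varied_lagrangian_cvg eps t :
  chart_img (1%g : G) (chart_line (G := G) (h t) eps) ->
  varied_lagrangian eps @ t --> varied_lagrangian eps t.
Proof.
move=> himg.
have cu : (fun t => up i0 t + eps *: du0 t) @ t --> up i0 t + eps *: du0 t.
  by apply: cvgD; [exact: cup|apply: cvgZ; [exact: cvg_cst|exact: du0_continuous]].
have cl : (fun t => chart_line (G := G) (h t) eps) @ t --> chart_line (G := G) (h t) eps.
  by apply: cvgD; [exact: cvg_cst|apply: cvgZ; [exact: cvg_cst|exact: ch]].
apply: cvgD; first apply: cvgD.
- exact: rest_lagrangian_continuous.
- apply: cvgD; first exact: (@cvg_cost _ (nbhs t) _ i0 _ _ cu).
  exact: (@cvg_pairing _ _ _ (nbhs t) _ _ _ _ _ (@clc i0 t) cu).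
- apply: cvg_bigsum => j Ej.
  apply: (@cvg_potential _ _ _ _ (nbhs t)); first by apply: Vreg; rewrite Esym.
    exact: rel_continuous.
  exact: (@cvg_chart_inv_comp _ _ _ _ (nbhs t) _ _ _ _ himg cl).
Qed.

Lemma varied_lagrangian_derive_cvg (z : R * R) :
  chart_img (1%g : G) (chart_line (G := G) (h z.2) z.1) ->
  (fun y : R * R => varied_lagrangian_derive y.1 y.2) @ z -->
    varied_lagrangian_derive z.1 z.2.
Proof.
move=> himg.
have snd_cont (W : topologicalType) (f : R -> W) : continuous f ->
    (fun y : R * R => f y.2) @ z --> f z.2.
  by move=> cf; exact: (cvg_comp snd f cvg_snd (cf z.2)).
have cdu := snd_cont _ _ du0_continuous.
have cu : (fun y : R * R => up i0 y.2 + y.1 *: du0 y.2) @ z -->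
    up i0 z.2 + z.1 *: du0 z.2.
  apply: cvgD; first exact: (snd_cont _ (up i0)).
  by apply: cvgZ; [exact: cvg_fst|exact: cdu].
have chz := snd_cont _ _ ch.
have cl := cvg_chart_line (G := G) (z := z) ch.
apply: cvgD; first apply: cvgD.
- exact: (@cvg_cost_derive _ (nbhs z) _ i0 _ _ _ _ cu cdu).
- exact: (@cvg_pairing _ _ _ (nbhs z) _ _ _ _ _ (snd_cont _ _ (@clc i0)) cdu).
- apply: cvg_bigsum => j Ej.
  have Vji : C1_pair (V j i0) by apply: Vreg; rewrite Esym.
  exact: (@cvg_potential_derive _ _ _ _ (nbhs z) _ _ _ _ _ _ _ _ _ Vji himg
    (snd_cont _ _ (@rel_continuous j)) cl chz).
Qed.

Definition momentum (t : R) : 'cV[R]_n :=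
  partial_u C i0 (gm i0 t) (up i0 t) + lc i0 t.

Definition momentum_rate (t : R) : 'cV[R]_n :=
  coad (G := G) (up i0 t) (momentum t)
  + \sum_(j | E i0 j) force i0 j (gm i0 t) (gm j t).

Lemma pairing_momentum t v :
  pairing (momentum t) v = 'D_v (C i0 1%g) (up i0 t) + pairing (lc i0 t) v.
Proof. by rewrite /momentum pairingDl cost_covector. Qed.

Lemma pairing_momentum_rate t v : pairing (momentum_rate t) v =
  pairing (momentum t) (lie_bracket (G := G) (up i0 t) v)
  + \sum_(j | E i0 j) 'D_v (V j i0 ((gm i0 t)^-1 * gm j t)%g
       \o chart_inv (1%g : G)) x0.
Proof.
rewrite /momentum_rate pairingDl pairing_dual_map; last exact: lie_bracket_linearr.
rewrite pairing_suml; congr (_ + _); apply: eq_bigr => j Ej.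
by rewrite -pairing_force.
Qed.

Lemma pairing_momentum_continuous (w : R -> 'rV[R]_n) : continuous w ->
  continuous (fun t => pairing (momentum t) (w t)).
Proof.
move=> cw; rewrite (_ : (fun t => _) = (fun t =>
    'D_(w t) (C i0 1%g) (up i0 t) + pairing (lc i0 t) (w t))); last first.
  by apply/funext => t; rewrite pairing_momentum.
move=> t; apply: cvgD.
  exact: (@cvg_cost_derive _ (nbhs t) _ i0 _ _ _ _ (@cup i0 t) (cw t)).
exact: (@cvg_pairing _ _ _ (nbhs t) _ _ _ _ _ (@clc i0 t) (cw t)).
Qed.

Lemma pairing_momentum_rate_continuous (v : 'rV[R]_n) :
  continuous (fun t => pairing (momentum_rate t) v).
Proof.
rewrite (_ : (fun t => _) = (fun t =>
    pairing (momentum t) (lie_bracket (G := G) (up i0 t) v)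
  + \sum_(j | E i0 j) 'D_v (V j i0 ((gm i0 t)^-1 * gm j t)%g
       \o chart_inv (1%g : G)) x0)); last first.
  by apply/funext => t; rewrite pairing_momentum_rate.
move=> t; apply: cvgD.
  apply: pairing_momentum_continuous => s.
  by apply: cvg_lie_bracket; [exact: cup|exact: cvg_cst].
apply: cvg_bigsum => j Ej.
have Vji : C1_pair (V j i0) by apply: Vreg; rewrite Esym.
exact: (@cvg_potential_derive _ _ _ _ (nbhs t) _ _ _ _ (fun=> x0) (fun=> v) _ _ _ Vji
  (chart_img_center _) (@rel_continuous j t) (cvg_cst _) (cvg_cst _)).
Qed.

Lemma varied_lagrangian_derive0 t : varied_lagrangian_derive 0 t =
  pairing (momentum t) (dh t) + pairing (momentum_rate t) (h t).
Proof.
rewrite /varied_lagrangian_derive scale0r addr0 chart_line0 -pairing_momentum.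
rewrite pairing_momentum_rate addrA; congr (_ + _).
by rewrite /du0 pairingDr.
Qed.

Lemma stationary_weak (T a : R) (g : 'I_r -> R -> G) (u : 'I_r -> R -> 'rV[R]_n)
    (l : 'I_r -> R -> 'cV[R]_n) : 0 < T -> 0 < a ->
  (forall i t, t \in `[0, T] -> gm i t = g i t) ->
  (forall i t, t \in `[0, T] -> up i t = u i t) ->
  (forall i t, t \in `[0, T] -> lc i t = l i t) ->
  (forall t, t \in `[0, T] -> deriv_in `[0, T] h t (dh t)) ->
  h 0 = 0 -> h T = 0 ->
  (forall x : R * R, strip a T x ->
     chart1_invertible (G := G) (chart_line (G := G) (h x.2) x.1)) ->
  stationary E C V T g u l ->
  \int[mu]_(t in `[0, T])
    (pairing (momentum t) (dh t) + pairing (momentum_rate t) (h t)) = 0.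
Proof.
move=> T0 a0 gmE upE lcE dhE h0 hT hgood stat.
have c0 : continuous (fun _ : R => 0 : 'rV[R]_n) by move=> t; exact: cvg_cst.
have var : Defs.variation T g u varied_g varied_u.
  exists a => // i.
  (* Agents other than [i0] receive the zero test curve, so that one construction and one radius [a]
     cover all of them. *)
  have [sh|sh] : (forall f, single f i = f) \/ (forall f, single f i = (fun=> 0)).
  - by rewrite /single; case: (i =P i0) => _; [left|right].
  - apply: (@agent_variation_perturb R n G T a (g i) (gm i) (u i) (up i)
      (single h i) (single dh i)); rewrite ?sh //; first exact: ltW.
      exact: gmE.
    exact: upE.
  - apply: (@agent_variation_perturb R n G T a (g i) (gm i) (u i) (up i)
      (single h i) (single dh i)); rewrite ?sh //; first exact: ltW.
    + exact: gmE.
    + exact: upE.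
    + by move=> t _; apply: is_derive_deriv_in; exact: is_derive_cst.
    + by move=> x _; rewrite /chart_line scaler0 addr0; exact: chart1_invertible_center.
have := stat _ _ var.
have actE eps : action E C V T (varied_g eps) (varied_u eps) l =
    \int[mu]_(t in `[0, T]) varied_lagrangian eps t.
  apply: eq_Rintegral => t; rewrite inE => tT; rewrite -varied_lagrangianE.
  congr (lagrangian _ _ _ _ _ (translated_multiplier _ _)).
  by apply/funext => i; rewrite lcE.
rewrite (_ : (fun eps => _) =
    (fun eps => \int[mu]_(t in `[0, T]) varied_lagrangian eps t)); last first.
  by apply/funext => eps; exact: actE.
move=> [_ stat0].
(* Stationarity says that the derivative of the action is 0; computed under the integral sign, the
   same derivative is the weak form. *)
have [_] : is_derive (0 : R) (1 : R)
    (fun eps => \int[mu]_(t in `[0, T]) varied_lagrangian eps t)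
    (\int[mu]_(t in `[0, T]) varied_lagrangian_derive 0 t).
  apply: (@is_derive_under_integral R T a) => //.
  - move=> eps epsa; apply/subspace_continuousP => t tT.
    apply: cvg_within_filter; apply: varied_lagrangian_cvg.
    by have [] := hgood (eps, t) (conj epsa tT).
  - move=> eps t st; apply: varied_lagrangian_is_derive.
    by have [] := hgood (eps, t) st.
  - apply/subspace_continuousP => z zs; apply: cvg_within_filter.
    by apply: varied_lagrangian_derive_cvg; have [] := hgood z zs.
rewrite stat0 => E0; rewrite [RHS]E0; apply: eq_Rintegral => t _.
by rewrite varied_lagrangian_derive0.
Qed.

End Curves.
End FirstVariation.

(** * From the weak form to the equations of motion *)

Lemma momentum_equation (R : realType) (n r : nat) (G : lieGroupType R n)
    (E : rel 'I_r) (C : 'I_r -> G -> 'rV[R]_n -> R)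
    (V : 'I_r -> 'I_r -> G -> G -> R) (T : R)
    (gm g : 'I_r -> R -> G) (up u : 'I_r -> R -> 'rV[R]_n)
    (lc l : 'I_r -> R -> 'cV[R]_n) (i0 : 'I_r) :
  symmetric E -> irreflexive E -> (forall i g, Ck 1 (C i g) setT) ->
  (forall i (h g : G) u, C i (ltrans h g) u = C i g u) ->
  (forall i j, E i j -> forall g h, V i j g h = V j i h g) ->
  (forall i j, E i j ->
     forall h g1 g2, V i j (ltrans h g1) (ltrans h g2) = V i j g1 g2) ->
  (forall i j, E i j -> C1_pair (V i j)) ->
  0 < T -> (forall i, continuous (gm i)) -> (forall i, continuous (up i)) ->
  (forall i, continuous (lc i)) ->
  (forall i t, t \in `[0, T] -> gm i t = g i t) ->
  (forall i t, t \in `[0, T] -> up i t = u i t) ->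
  (forall i t, t \in `[0, T] -> lc i t = l i t) ->
  stationary E C V T g u l ->
  forall t, t \in `[0, T] ->
    deriv_in `[0, T] (momentum (C := C) i0 gm up lc) t
      (momentum_rate (E := E) (C := C) (V := V) i0 gm up lc t).
Proof.
move=> Esym Eirr Creg Cinv Vsym Vinv Vreg T0 cgm cup clc gmE upE lcE stat t tT.
(* Coordinate [k] of the momentum is tested by curves [phi t *: delta_mx 0 k], which makes the
   scalar lemma applicable. *)
apply: deriv_in_col => k.
have cp : continuous (fun t => momentum (C := C) i0 gm up lc t k 0).
  rewrite (_ : (fun t => _) =
    (fun t => pairing (momentum (C := C) i0 gm up lc t) (delta_mx 0 k))).
    by apply: (pairing_momentum_continuous Creg Cinv cup clc) => s; exact: cvg_cst.
  by apply/funext => s; rewrite pairing_delta.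
have cq : continuous
    (fun t => momentum_rate (E := E) (C := C) (V := V) i0 gm up lc t k 0).
  rewrite (_ : (fun t => _) = (fun t =>
      pairing (momentum_rate (E := E) (C := C) (V := V) i0 gm up lc t) (delta_mx 0 k))).
    exact: (pairing_momentum_rate_continuous Esym Creg Cinv Vsym Vinv Vreg cgm cup clc).
  by apply/funext => s; rewrite pairing_delta.
apply: (du_bois_reymond T0 cp cq) tT => phi dphi cphi cdphi [H phiH] dphiE phi0 phiT.
pose e := delta_mx 0 k : 'rV[R]_n.
have [a a0 Ha] := chart1_invertible_small (G := G) e phiH.
have ch : continuous (fun t => phi t *: e).
  by move=> s; apply: cvgZ; [exact: cphi|exact: cvg_cst].
have cdh : continuous (fun t => dphi t *: e).
  by move=> s; apply: cvgZ; [exact: cdphi|exact: cvg_cst].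
have dhE s : s \in `[0, T] -> deriv_in `[0, T] (fun t => phi t *: e) s (dphi s *: e).
  by move=> sT; apply: deriv_inZl; exact: dphiE.
have h0 : phi 0 *: e = 0 by rewrite phi0 scale0r.
have hT : phi T *: e = 0 by rewrite phiT scale0r.
have hgood x : strip a T x ->
    chart1_invertible (G := G) (chart_line (G := G) (phi x.2 *: e) x.1).
  by move=> [xa _]; exact: Ha.
rewrite -[RHS](stationary_weak Esym Eirr Creg Cinv Vsym Vinv Vreg i0 cgm cup clc ch cdh
  T0 a0 gmE upE lcE dhE h0 hT hgood stat).
apply: eq_Rintegral => s _.
by rewrite !pairingZr !pairing_delta mulrC [X in _ + X]mulrC.
Qed.

Theorem theorem4p1 (R : realType) (n r m : nat) (G : lieGroupType R n)
  (e : 'I_n -> 'rV[R]_n) (estar : 'I_n -> 'cV[R]_n)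
  (he : basis_of fullv [tuple e k | k < n])
  (hestar : forall k l, pairing (estar k) (e l) = (k == l)%:R)
  (hm : (m <= n)%N)
  (E : rel 'I_r) (hEsym : symmetric E) (hEirr : irreflexive E)
  (hEconn : forall i j, connect E i j)
  (C : 'I_r -> G -> 'rV[R]_n -> R)
  (hCreg : forall i g, Ck 1 (C i g) setT)
  (hCinv : forall i (h g : G) u, C i (ltrans h g) u = C i g u)
  (V : 'I_r -> 'I_r -> G -> G -> R)
  (hVsym : forall i j, E i j -> forall g h, V i j g h = V j i h g)
  (hVinv : forall i j, E i j ->
     forall h g1 g2, V i j (ltrans h g1) (ltrans h g2) = V i j g1 g2)
  (hVreg : forall i j, E i j -> C1_pair (V i j))
  (hCtot : forall (h : G) (g : 'I_r -> G) (u : 'I_r -> 'rV[R]_n),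
     total_cost C (fun i => ltrans h (g i)) u = total_cost C g u)
  (T : R) (hT : 0 < T) (gini gfin : 'I_r -> G)
  (g : 'I_r -> R -> G) (u : 'I_r -> R -> 'rV[R]_n)
  (lam : 'I_r -> R -> 'cV[R]_n)
  (hext : extremal E C V m e estar T gini gfin g u lam) :
  forall i t, t \in `[0, T] ->
    (exists dp : 'cV[R]_n,
       deriv_in `[0, T]
         (fun s => partial_u C i (g i s) (u i s) + lam i s) t dp /\
       0 = dp
           - coad (G := G) (u i t) (partial_u C i (g i t) (u i t) + lam i t)
           - \sum_(j | E i j)
               cotangent_map (ltrans (g i t)) 1%g
                 (differential
                    (fun h => reduced_potential V i j (ltrans h^-1%g (g j t)))
                    (g i t)))
    /\ velocity `[0, T] (g i) t (tangent_map (ltrans (g i t)) 1%g (u i t)).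
Proof.
case: hext => -[gC1 gkin _ _ _] [lC1 _] stat i t tT.
split; last exact: gkin.
have T0 := ltW hT.
(* The hypotheses govern the curves on [0, T] only; their clamped versions are continuous on the
   line and agree with them on the segment. *)
have cgm j : continuous (g j \o clamp T).
  apply: continuous_clamp_comp => //; apply/subspace_continuousP => s sT.
  by have [] := gC1 j s sT.
have cup j : continuous (u j \o clamp T).
  apply: continuous_clamp_comp => //.
  by apply: (control_continuous hT (gC1 j)); exact: gkin.
have clc j : continuous (lam j \o clamp T).
  apply: continuous_clamp_comp => //; apply/subspace_continuousP => s sT.
  by have [dl [_ /(_ s sT)]] := lC1 j; exact: deriv_in_continuous.
have clE (S : Type) (f : 'I_r -> R -> S) j s : s \in `[0, T] -> (f j \o clamp T) s = f j s.
  by move=> sT; rewrite /= clampE.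
have deq := momentum_equation (i0 := i) hEsym hEirr hCreg hCinv hVsym hVinv hVreg hT
  cgm cup clc (clE _ g) (clE _ u) (clE _ lam) stat tT.
(* The derivative is exhibited in the very form of the right-hand side, so the equation itself
   reduces to a cancellation. *)
exists (coad (G := G) (u i t) (partial_u C i (g i t) (u i t) + lam i t)
  + \sum_(j | E i j) force (V := V) i j (g i t) (g j t)); split; last first.
  by rewrite -addrA -opprD subrr.
move: deq; rewrite /momentum_rate /momentum /= !clampE//.
by apply: eq_deriv_in => // s sT; rewrite clampE.
Qed.
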